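(* Let $M$ be a II$_1$ factor that is separable, existentially closed (e.c.), and self-tracially stable. Then $M$ has the Jung property.
   Context: A tracial von Neumann algebra is a von Neumann algebra equipped with a fixed faithful normal tracial state; separable means separable in the associated 2-norm. An embedding between tracial von Neumann algebras is a unital trace-preserving (hence injective) $*$-homomorphism; inclusions of tracial von Neumann algebras are unital and trace-preserving; $*$-homomorphisms are unital. For an ultrafilter $\mathcal U$, $M^{\mathcal U}$ denotes the tracial ultrapower, and the diagonal embedding $M\to M^{\mathcal U}$ sends $x$ to the class of the constant family $x$. A tracial von Neumann algebra $M$ is existentially closed (e.c.) if, whenever $M$ is contained in a tracial von Neumann algebra $N$, there is an embedding of $N$ into some ultrapower $M^{\mathcal U}$ (with $\mathcal U$ an ultrafilter on a possibly large index set; when $M$ and $N$ are separable one may use nonprincipal ultrafilters on $\mathbb N$) whose restriction to $M$ is the diagonal embedding. $M$ is self-tracially stable if for every nonprincipal ultrafilter $\mathcal U$ on $\mathbb N$ and every embedding $f:M\to M^{\mathcal U}$ there are $*$-homomorphisms $f_i:M\to M$ ($i\in\mathbb N$) such that $f(x)=(f_i(x))_{\mathcal U}$ for all $x\in M$. A separable II$_1$ factor $M$ has the Jung property if for every nonprincipal ultrafilter $\mathcal U$ on $\mathbb N$, every embedding $f:M\to M^{\mathcal U}$ is unitarily conjugate to the diagonal embedding, i.e. there is a unitary $u\in M^{\mathcal U}$ with $uf(x)u^*=x$ for all $x\in M$ (identifying $M$ with its diagonal image). *)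

(* Defs.v *)
From HB Require Import structures.
From mathcomp Require Import all_boot all_order all_algebra.
From mathcomp Require Import generic_quotient complex.
From mathcomp Require Import boolp classical_sets functions reals.
From mathcomp Require Import topology normedtype.
From mathcomp Require Import ring lra.
Set Implicit Arguments.
Unset Strict Implicit.
Unset Printing Implicit Defensive.

Import Order.TTheory GRing.Theory Num.Theory numFieldNormedType.Exports.

Local Open Scope classical_set_scope.
Local Open Scope ring_scope.
Local Open Scope complex_scope.

(* A complex Hilbert space: the scalars are R[i] for an arbitrary model R of the
   real numbers, and the inner product is linear in its first argument. *)
HB.mixin Record NormedModule_isHilbert (R : realType) H
    & CompleteNormedModule R[i] H := {
  ip : H -> H -> R[i];
  ip_linear : forall a u v w, ip (a *: u + v) w = a * ip u w + ip v w;
  ipC : forall v w, ip w v = (ip v w)^*;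
  ip_norm : forall v, ip v v = `|v| ^+ 2
}.
#[short(type="hilbertType")]
HB.structure Definition Hilbert (R : realType) :=
  {H of NormedModule_isHilbert R H & CompleteNormedModule R[i] H}.

HB.mixin Record Algebra_isStar (R : realType) A & GRing.Algebra R[i] A := {
  star : A -> A;
  starK : involutive star;
  starD : {morph star : x y / x + y};
  starZ : forall a x, star (a *: x) = a^* *: star x;
  starM : forall x y, star (x * y) = star y * star x
}.
#[short(type="starAlgType")]
HB.structure Definition StarAlgebra (R : realType) :=
  {A of Algebra_isStar R A & GRing.Algebra R[i] A}.

(* A unital complex *-algebra with a faithful tracial state. This is the common
   interface of tracial von Neumann algebras and of their ultrapowers, and all
   that is needed to speak of embeddings. *)
HB.mixin Record StarAlgebra_isTracial (R : realType) A & StarAlgebra R A := {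
  trace : A -> R[i];
  trace_linear : forall a x y, trace (a *: x + y) = a * trace x + trace y;
  trace1 : trace 1 = 1;
  traceC : forall x y, trace (x * y) = trace (y * x);
  trace_ge0 : forall x, 0 <= trace (star x * x);
  trace_eq0 : forall x, trace (star x * x) = 0 -> x = 0
}.
#[short(type="tracialStarAlgType")]
HB.structure Definition TracialStarAlgebra (R : realType) :=
  {A of StarAlgebra_isTracial R A & StarAlgebra R A}.

(* A von Neumann algebra is a unital *-algebra of bounded operators on a Hilbert
   space [vnspace] that is closed in the weak operator topology. The elements are
   kept abstract and [rep] identifies them with operators: it is an injective
   unital *-homomorphism into B(vnspace), and [rep_wot_closed] says that its
   range contains every bounded operator that is a WOT-limit, along some proper
   filter, of operators in the range. *)
HB.mixin Record StarAlgebra_isVonNeumann (R : realType) A & StarAlgebra R A := {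
  vnspace : hilbertType R;
  rep : A -> {linear vnspace -> vnspace};
  rep_continuous : forall x, continuous (rep x);
  rep_linear : forall a x y v, rep (a *: x + y) v = a *: rep x v + rep y v;
  repM : forall x y v, rep (x * y) v = rep x (rep y v);
  rep1 : forall v, rep 1 v = v;
  rep_star : forall x v w, ip (rep (star x) v) w = ip v (rep x w);
  rep_inj : forall x, (forall v, rep x v = 0) -> x = 0;
  rep_wot_closed : forall (T : {linear vnspace -> vnspace}) (F : set_system A),
    continuous T -> ProperFilter F ->
    (forall v w,
      (fun x => ip (rep x v) w : R[i]^o) @ F --> (ip (T v) w : R[i]^o)) ->
    exists x, forall v, rep x v = T v
}.
#[short(type="vonNeumannType")]
HB.structure Definition VonNeumann (R : realType) :=
  {A of StarAlgebra_isVonNeumann R A & StarAlgebra R A}.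

Arguments vnspace {R} s.

(* The operator order; as the scalars are complex, [0 <= z] includes that z is
   real, so [le_op x y] implies that y - x is self-adjoint. *)
Definition le_op (R : realType) (A : vonNeumannType R) (x y : A) :=
  forall v : vnspace A, 0 <= ip (rep (y - x) v) v.

Definition is_sup_op (R : realType) (A : vonNeumannType R) (D : set A) (s : A) :=
  (forall a, D a -> le_op a s) /\
  (forall t, (forall a, D a -> le_op a t) -> le_op s t).

(* Normality of the trace: it preserves the supremum of every upward directed set
   of self-adjoint elements that has one. *)
HB.mixin Record VonNeumann_isNormalTracial (R : realType) A
    & VonNeumann R A & TracialStarAlgebra R A := {
  trace_normal : forall (D : set A) (s : A), D !=set0 ->
    (forall a, D a -> star a = a) ->
    (forall a b, D a -> D b -> exists2 c, D c & le_op a c /\ le_op b c) ->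
    is_sup_op D s -> supremums (trace @` D) (trace s)
}.
#[short(type="tracialVNType")]
HB.structure Definition TracialVonNeumann (R : realType) :=
  {A of VonNeumann_isNormalTracial R A & VonNeumann R A & TracialStarAlgebra R A}.

Record ultrafilter (I : Type) :=
  Ultrafilter { ultra_sets :> set_system I; ultraP : UltraFilter ultra_sets }.
#[global] Existing Instance ultraP.

Definition nonprincipal (I : Type) (U : ultrafilter I) :=
  ~ exists i : I, U = principal_filter i :> set_system I.

(* The operator norm of x is at most K. *)
Definition op_bounded (R : realType) (A : vonNeumannType R) (K : R) (x : A) :=
  forall v : vnspace A, `|rep x v| <= K%:C * `|v|.

Definition sqnorm2 (R : realType) (A : tracialStarAlgType R) (x : A) : R :=
  complex.Re (trace (star x * x)).

(* The 2-norm associated with the trace. *)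
Definition norm2 (R : realType) (A : tracialStarAlgType R) (x : A) : R :=
  Num.sqrt (sqnorm2 x).

Section TraceFacts.
Context {R : realType} {A : tracialStarAlgType R}.
Implicit Types (x y : A) (a : R[i]).

Fact trace_is_linear : linear_for *%R (@trace R A).
Proof. exact: trace_linear. Qed.
HB.instance Definition _ :=
  @GRing.isLinear.Build R[i] A R[i] *%R (@trace R A) trace_is_linear.

Fact star0 : star (0 : A) = 0.
Proof. by apply: (addIr (star 0)); rewrite -starD !add0r. Qed.
Fact starN x : star (- x) = - star x.
Proof. by apply: (addIr (star x)); rewrite -starD !addNr star0. Qed.
Fact starB x y : star (x - y) = star x - star y.
Proof. by rewrite starD starN. Qed.
Fact star1 : star (1 : A) = 1.
Proof. by rewrite -[LHS]mulr1 -{2}[1 : A]starK -starM mulr1 starK. Qed.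

Fact traceN x : trace (- x) = - trace x.
Proof. exact: raddfN. Qed.
Fact traceB x y : trace (x - y) = trace x - trace y.
Proof. exact: raddfB. Qed.
Fact traceD x y : trace (x + y) = trace x + trace y.
Proof. exact: raddfD. Qed.
Fact traceZ a x : trace (a *: x) = a * trace x.
Proof. exact: linearZ. Qed.
Fact ReN (z : R[i]) : complex.Re (- z) = - complex.Re z.
Proof. by case: z. Qed.

Fact traceE2 x : trace (star x * x) = (sqnorm2 x)%:C.
Proof.
have := trace_ge0 x; rewrite lecE /= => /andP[/eqP E _].
by rewrite /sqnorm2; case: (trace _) E => a b /= ->.
Qed.

Fact sqnorm2_ge0 x : 0 <= sqnorm2 x.
Proof. by have := trace_ge0 x; rewrite lecE /= => /andP[]. Qed.

Fact norm2_sqr x : norm2 x ^+ 2 = sqnorm2 x.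
Proof. by rewrite sqr_sqrtr// sqnorm2_ge0. Qed.

Fact trace_star x : trace (star x) = (trace x)^*.
Proof.
have H (t : R[i]) : complex.Im (t^* * trace x + t * trace (star x)) = 0.
  have := trace_ge0 (t%:A + x).
  rewrite starD starZ star1 mulrDl !mulrDr !raddfD /= -!scalerAl -!scalerAr.
  rewrite !mul1r mulr1 !linearZ /= trace1 mulr1 traceE2.
  have := mulcJ_ge0 t; rewrite mulrC.
  rewrite !lecE => /andP[/eqP t0 _] /andP[/eqP + _].
  by rewrite !raddfD /= t0 !add0r addr0.
have := H 1; have := H 'i; case: (trace x) => a b; case: (trace (star x)) => c d.
rewrite /= !(mul0r, mulr0, mul1r, mulr1, oppr0, addr0, add0r, mulN1r, subr0).
move=> /eqP; rewrite addrC subr_eq0 => /eqP -> /eqP; rewrite addrC addr_eq0.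
by move=> /eqP ->.
Qed.

Fact sqnorm2_starE x : sqnorm2 (star x) = sqnorm2 x.
Proof. by rewrite /sqnorm2 starK traceC. Qed.

Fact sqnorm2_eq0 x : sqnorm2 x = 0 -> x = 0.
Proof. by move=> x0; apply: trace_eq0; rewrite traceE2 x0. Qed.

Fact sqnorm2N x : sqnorm2 (- x) = sqnorm2 x.
Proof. by rewrite /sqnorm2 starN mulrNN. Qed.

Fact sqnorm2D x y : sqnorm2 (x + y) <= 2 * sqnorm2 x + 2 * sqnorm2 y.
Proof.
have : sqnorm2 (x + y) + sqnorm2 (x - y) = 2 * sqnorm2 x + 2 * sqnorm2 y.
  rewrite /sqnorm2 -!raddfD /= starB starD !mulrDl !mulrDr !mulrN !mulNr !raddfD /=.
  rewrite !opprK !(traceN, ReN) !mul1r.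
  by lra.
by move=> <-; rewrite lerDl sqnorm2_ge0.
Qed.

Fact sqnorm2Z a x : sqnorm2 (a *: x) = complex.Re (a * a^*) * sqnorm2 x.
Proof.
rewrite /sqnorm2 starZ -scalerAl -scalerAr !linearZ /= traceE2 /=.
by case: a => a b /=; rewrite !mulr0 !subr0; ring.
Qed.

Fact trace_bound x :
  complex.Re (trace x) ^+ 2 + complex.Im (trace x) ^+ 2 <= sqnorm2 x.
Proof.
have := sqnorm2_ge0 (x - (trace x)%:A).
rewrite /sqnorm2 starB starZ star1 mulrDl !mulrDr !mulrN !mulNr.
rewrite -!scalerAl -!scalerAr.
rewrite !mul1r mulr1 !opprK !(traceD, traceN, traceZ) trace1 mulr1.
rewrite traceE2 trace_star; case: (trace x) => a b /=; lra.
Qed.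
End TraceFacts.

Section VNFacts.
Context {R : realType}.

Section Hilb.
Context {H : hilbertType R}.
Implicit Types u v w : H.

Fact ipDl u v w : ip (u + v) w = ip u w + ip v w.
Proof. by have := ip_linear 1 u v w; rewrite scale1r mul1r. Qed.
Fact ip0l w : ip 0 w = 0.
Proof. by apply: (addIr (ip 0 w)); rewrite -ipDl !add0r. Qed.
Fact ipZl a u w : ip (a *: u) w = a * ip u w.
Proof. by have := ip_linear a u 0 w; rewrite addr0 ip0l addr0. Qed.
Fact ipNl u w : ip (- u) w = - ip u w.
Proof. by rewrite -scaleN1r ipZl mulN1r. Qed.
Fact ipDr u v w : ip w (u + v) = ip w u + ip w v.
Proof. by rewrite ipC ipDl rmorphD /= -!ipC. Qed.
Fact ipZr a u w : ip w (a *: u) = a^* * ip w u.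
Proof. by rewrite ipC ipZl rmorphM /= -!ipC. Qed.
Fact ipNr u w : ip w (- u) = - ip w u.
Proof. by rewrite ipC ipNl rmorphN /= -!ipC. Qed.
Definition hnorm v : R := complex.Re `|v|.
Fact hnormE v : `|v| = (hnorm v)%:C.
Proof.
have : 0 <= `|v| by [].
by rewrite lecE /hnorm => /andP[/eqP]; case: (`|v|) => a b /= ->.
Qed.
Fact hnorm_ge0 v : 0 <= hnorm v.
Proof. by have : 0 <= `|v| by []; rewrite lecE => /andP[]. Qed.
Fact ip_hnorm v : ip v v = (hnorm v ^+ 2)%:C.
Proof. by rewrite ip_norm hnormE rmorphXn. Qed.
End Hilb.

Section VN.
Context {A : vonNeumannType R}.
Implicit Types (x y : A) (K L : R).
Fact repD x y v : rep (x + y) v = rep x v + rep y v.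
Proof. by have := rep_linear 1 x y v; rewrite !scale1r. Qed.
Fact rep0 v : rep (0 : A) v = 0.
Proof. by apply: (addIr (rep (0 : A) v)); rewrite -repD !add0r. Qed.
Fact repZ a x v : rep (a *: x) v = a *: rep x v.
Proof. by have := rep_linear a x 0 v; rewrite !addr0 rep0 addr0. Qed.
Fact repN x v : rep (- x) v = - rep x v.
Proof. by rewrite -scaleN1r repZ scaleN1r. Qed.

Fact op_boundedP (K : R) x :
  op_bounded K x <-> forall v, hnorm (rep x v) <= K * hnorm v.
Proof. by split=> h v; have := h v; rewrite !hnormE -rmorphM lecR. Qed.

Fact op_bounded_exists x : exists2 K : R, 0 < K & op_bounded K x.
Proof.
have /linear_boundedP := @continuous_linear_bounded _ _ _ 0 (rep x)
  (@rep_continuous R A x 0).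
move=> /pinfty_ex_gt0[K K0 h].
have KE : K = (complex.Re K)%:C.
  by move: K0; rewrite ltcE; case: (K) => a b /= /andP[/eqP ->].
exists (complex.Re K); first by move: K0; rewrite ltcE => /andP[].
by move=> v; rewrite -KE.
Qed.

Fact op_bounded_le (K L : R) x : K <= L -> op_bounded K x -> op_bounded L x.
Proof.
move=> KL /op_boundedP h; apply/op_boundedP => v; apply: le_trans (h v) _.
by rewrite ler_wpM2r// hnorm_ge0.
Qed.

Fact op_boundedD K L x y :
  op_bounded K x -> op_bounded L y -> op_bounded (K + L) (x + y).
Proof.
move=> h k v; rewrite repD rmorphD mulrDl (le_trans (ler_normD _ _))//.
exact: lerD.
Qed.

Fact op_boundedN K x : op_bounded K x -> op_bounded K (- x).
Proof. by move=> h v; rewrite repN normrN. Qed.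

Fact op_boundedZ K a x :
  op_bounded K x -> op_bounded (complex.Re `|a| * K) (a *: x).
Proof.
move=> h v; rewrite repZ normrZ rmorphM -mulrA /=.
have -> : (complex.Re `|a|)%:C = `|a|.
  by have := normr_ge0 a; rewrite lecE; case: (`|a|) => ? ? /= /andP[/eqP ->].
exact: ler_wpM2l.
Qed.

Fact op_boundedM K L x y : 0 <= K ->
  op_bounded K x -> op_bounded L y -> op_bounded (K * L) (x * y).
Proof.
move=> K0 h k v; rewrite repM (le_trans (h _))// rmorphM -mulrA.
by rewrite ler_wpM2l// (lecR 0).
Qed.

Fact op_bounded0 : op_bounded 0 (0 : A).
Proof. by move=> v; rewrite rep0 normr0 mul0r. Qed.

Fact op_bounded1 : op_bounded 1 (1 : A).
Proof. by move=> v; rewrite rep1 mul1r. Qed.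

Fact op_bounded_star K x : 0 < K -> op_bounded K x -> op_bounded K (star x).
Proof.
move=> K0 /op_boundedP h; apply/op_boundedP => v.
rewrite -ler_sqr ?nnegrE ?hnorm_ge0 ?mulr_ge0 ?hnorm_ge0 ?(ltW K0)//.
set w := rep (star x) v.
have [c [cE c2]] : exists c, ip v (rep x w) = c%:C /\ c = hnorm w ^+ 2.
  by exists (hnorm w ^+ 2); rewrite -rep_star ip_hnorm.
have : 0 <= ip ((K ^+ 2)%:C *: v - rep x w) ((K ^+ 2)%:C *: v - rep x w).
  by rewrite ip_hnorm lecR sqr_ge0.
rewrite ipDl !ipDr !ipNl !ipNr !ipZl !ipZr.
rewrite [ip (rep x w) v]ipC cE !ip_hnorm !conjc_real.
rewrite lecE => /andP[_] /=; rewrite c2 !(mul0r,mulr0,subr0,oppr0,addr0).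
have : hnorm (rep x w) ^+ 2 <= K ^+ 2 * hnorm w ^+ 2.
  by rewrite -exprMn ler_sqr ?nnegrE ?hnorm_ge0 ?mulr_ge0 ?hnorm_ge0 ?(ltW K0).
have K2 : 0 < K ^+ 2 by rewrite exprn_gt0.
rewrite exprMn; move: (K ^+ 2) (hnorm w ^+ 2) (hnorm v ^+ 2) (hnorm _ ^+ 2) K2.
move=> k a b d k0 da H.
rewrite -(ler_pM2l k0); nra.
Qed.

Fact le_op_refl x : le_op x x.
Proof. by move=> v; rewrite subrr rep0 ip0l. Qed.
End VN.

Section TVN.
Context {M : tracialVNType R}.
Implicit Types (x y : M) (K : R).

Fact trace_le x y : star x = x -> star y = y -> le_op x y -> trace x <= trace y.
Proof.
move=> sx sy xy.
have [] := @trace_normal R M [set x; y] y.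
- by exists x; left.
- by move=> a [->|->].
- have h a : [set x; y] a -> le_op a y by move=> [->|->] //; exact: le_op_refl.
  by move=> a b /h ? /h ?; exists y; [right|].
- split; first by move=> a [->|->] //; exact: le_op_refl.
  by move=> t; apply; right.
- by move=> + _; apply; exists x; [left|].
Qed.

Fact sqnorm2_mull K x y : op_bounded K x -> sqnorm2 (x * y) <= K ^+ 2 * sqnorm2 y.
Proof.
move=> /op_boundedP h; rewrite -lecR -traceE2.
have -> : (K ^+ 2 * sqnorm2 y)%:C = trace ((K ^+ 2)%:C *: (star y * y)).
  by rewrite traceZ traceE2 -rmorphM.
apply: trace_le.
- by rewrite !starM !starK.
- by rewrite starZ starM starK; congr (_ *: _); exact: conjc_real.
move=> v; rewrite repD repN repZ starM !repM ipDl ipNl ipZl.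
rewrite 3!rep_star !ip_hnorm subr_ge0 -(rmorphM (real_complex R)) lecR -exprMn.
have := h (rep y v) => hh.
by rewrite ler_sqr ?nnegrE ?hnorm_ge0 ?(le_trans (hnorm_ge0 _) hh).
Qed.

Fact sqnorm2_mulr K x y : 0 < K -> op_bounded K x ->
  sqnorm2 (y * x) <= K ^+ 2 * sqnorm2 y.
Proof.
move=> K0 h; rewrite -sqnorm2_starE starM -(sqnorm2_starE y).
by apply: sqnorm2_mull; exact: op_bounded_star.
Qed.

Fact sqnorm2_le K x : op_bounded K x -> sqnorm2 x <= K ^+ 2.
Proof.
move=> h; have := sqnorm2_mull 1 h; rewrite mulr1.
by rewrite {2}/sqnorm2 star1 mul1r trace1 mulr1.
Qed.
End TVN.
End VNFacts.

Local Open Scope quotient_scope.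

Fact bounded_ultra_cvg (R : realType) (I : Type) (U : ultrafilter I)
    (f : I -> R) (K : R) : (forall i, `|f i| <= K) ->
  f @ ultra_sets U --> lim (f @ ultra_sets U).
Proof.
move=> fK; apply/cvg_ex.
have [] := @segment_compact R (- K) K (f @ ultra_sets U) _.
  rewrite /nbhs /= /fmap /=; apply: filterS filterT => i _ /=.
  by rewrite in_itv /= -ler_norml.
move=> p [_ clp]; exists p => V Vp.
have [//|UV] := in_ultra_setVsetC (f @^-1` V) (ultraP U).
have [q [qnV qV]] := clp (~` V) V UV Vp.
by [].
Qed.

Section Ultrapower.
Context {R : realType} {M : tracialVNType R} {I : Type}.

Definition uniformly_bounded (x : I -> M) :=
  exists K : R, forall i, op_bounded K (x i).

(* The algebra of operator-norm bounded families in M. *)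
Record linfty := Linfty {
  linfty_fun :> I -> M;
  linfty_bounded : uniformly_bounded linfty_fun
}.

HB.instance Definition _ := gen_eqMixin linfty.
HB.instance Definition _ := gen_choiceMixin linfty.

Fact linfty_ext (x y : linfty) : x =1 y -> x = y.
Proof.
case: x y => [x bx] [y bY] /= /funext xy; subst y; congr Linfty.
exact: Prop_irrelevance.
Qed.

Fact uniformly_bounded_gt0 (x : I -> M) : uniformly_bounded x ->
  exists2 K : R, 0 < K & forall i, op_bounded K (x i).
Proof.
move=> [K h]; exists (Num.max K 1); first by rewrite lt_max ltr01 orbT.
by move=> i; apply: op_bounded_le (h i); rewrite le_max lexx.
Qed.

Fact uniformly_bounded_cst (x : M) : uniformly_bounded (fun=> x).
Proof. by have [K _ h] := op_bounded_exists x; exists K. Qed.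
Definition lcst x := Linfty (uniformly_bounded_cst x).

Fact uniformly_boundedD (x y : linfty) : uniformly_bounded (fun i => x i + y i).
Proof.
have [[K hx] [L hy]] := (linfty_bounded x, linfty_bounded y).
by exists (K + L) => i; exact: op_boundedD.
Qed.
Definition ladd x y := Linfty (uniformly_boundedD x y).

Fact uniformly_boundedN (x : linfty) : uniformly_bounded (fun i => - x i).
Proof.
by have [K hx] := linfty_bounded x; exists K => i; exact: op_boundedN.
Qed.
Definition lopp x := Linfty (uniformly_boundedN x).

Fact uniformly_boundedM (x y : linfty) : uniformly_bounded (fun i => x i * y i).
Proof.
have [K K0 hx] := uniformly_bounded_gt0 (linfty_bounded x).
have [L hy] := linfty_bounded y.
by exists (K * L) => i; apply: op_boundedM => //; exact: ltW.
Qed.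
Definition lmul x y := Linfty (uniformly_boundedM x y).

Fact uniformly_boundedZ a (x : linfty) : uniformly_bounded (fun i => a *: x i).
Proof.
have [K hx] := linfty_bounded x.
by exists (complex.Re `|a| * K) => i; exact: op_boundedZ.
Qed.
Definition lscale a x := Linfty (uniformly_boundedZ a x).

Fact uniformly_bounded_star (x : linfty) : uniformly_bounded (fun i => star (x i)).
Proof.
have [K K0 hx] := uniformly_bounded_gt0 (linfty_bounded x).
by exists K => i; exact: op_bounded_star.
Qed.
Definition lstar x := Linfty (uniformly_bounded_star x).

Context (U : ultrafilter I).

Definition unull (x : I -> M) := (fun i => norm2 (x i)) @ ultra_sets U --> (0 : R).

Fact unullP (x : I -> M) :
  unull x <-> (fun i => sqnorm2 (x i)) @ ultra_sets U --> (0 : R).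
Proof.
split=> h.
  have -> : (fun i => sqnorm2 (x i)) =
      (fun i => norm2 (x i)) \* (fun i => norm2 (x i)).
    by apply/funext => i /=; rewrite -expr2 norm2_sqr.
  by rewrite -(mulr0 (0 : R)); exact: cvgM.
apply/cvgrPdist_lt => e e0; have e2 : 0 < e ^+ 2 by rewrite exprn_gt0.
have /cvgrPdist_lt /(_ _ e2) := h; apply: filterS => i.
rewrite !sub0r !normrN !ger0_norm ?sqnorm2_ge0 ?sqrtr_ge0// -norm2_sqr.
by rewrite ltr_sqr ?nnegrE ?sqrtr_ge0 ?(ltW e0).
Qed.

Fact unull_le (x : I -> M) (f : I -> R) :
  f @ ultra_sets U --> (0 : R) -> (forall i, sqnorm2 (x i) <= f i) -> unull x.
Proof.
move=> f0 xf; apply/unullP; apply: (squeeze_cvgr _ (cvg_cst 0) f0).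
by apply: nearW => i; rewrite sqnorm2_ge0 xf.
Qed.

Fact unullD (x y : I -> M) : unull x -> unull y -> unull (fun i => x i + y i).
Proof.
move=> /unullP hx /unullP hy.
apply: (@unull_le _ (fun i => 2 * sqnorm2 (x i) + 2 * sqnorm2 (y i))); last first.
  by move=> i; exact: sqnorm2D.
have -> : (0 : R) = 2 * 0 + 2 * 0 by rewrite mulr0 addr0.
by apply: cvgD; apply: cvgMl_tmp.
Qed.

Fact unullMl (x : linfty) (y : I -> M) : unull y -> unull (fun i => x i * y i).
Proof.
have [K K0 hx] := uniformly_bounded_gt0 (linfty_bounded x).
move=> /unullP hy.
apply: (@unull_le _ (fun i => K ^+ 2 * sqnorm2 (y i))); last first.
  by move=> i; exact: sqnorm2_mull.
by rewrite -(mulr0 (K ^+ 2)); apply: cvgMl_tmp.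
Qed.

Fact unullMr (x : linfty) (y : I -> M) : unull y -> unull (fun i => y i * x i).
Proof.
have [K K0 hx] := uniformly_bounded_gt0 (linfty_bounded x).
move=> /unullP hy.
apply: (@unull_le _ (fun i => K ^+ 2 * sqnorm2 (y i))); last first.
  by move=> i; exact: sqnorm2_mulr.
by rewrite -(mulr0 (K ^+ 2)); apply: cvgMl_tmp.
Qed.

Fact unullN (y : I -> M) : unull y -> unull (fun i => - y i).
Proof. by move/unullP=> hy; apply: (unull_le hy) => i; rewrite sqnorm2N. Qed.

Fact unull_star (y : I -> M) : unull y -> unull (fun i => star (y i)).
Proof.
move=> /unullP hy; apply: (unull_le hy) => i.
by rewrite sqnorm2_starE.
Qed.

Fact unull0 : unull (fun=> 0).
Proof.
apply: (@unull_le _ (fun=> 0)); first exact: cvg_cst.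
by move=> i; rewrite /sqnorm2 mulr0 raddf0.
Qed.

(* Equality modulo the families that tend to 0 in 2-norm along U. *)
Definition ultra_eq (x y : linfty) := `[< unull (fun i => x i - y i) >].

Fact ultra_eq_refl : reflexive ultra_eq.
Proof.
move=> x; apply/asboolP; rewrite (_ : (fun i => _) = fun=> 0); first exact: unull0.
by apply/funext => i; rewrite subrr.
Qed.

Fact ultra_eq_sym : symmetric ultra_eq.
Proof.
have H x y : ultra_eq x y -> ultra_eq y x.
  move=> /asboolP /unullN h; apply/asboolP; move: h; congr unull.
  by apply/funext => i; rewrite opprB.
by move=> x y; apply/idP/idP; exact: H.
Qed.

Fact ultra_eq_trans : transitive ultra_eq.
Proof.
move=> y x z /asboolP h /asboolP k; apply/asboolP.
move: (unullD h k); congr unull; apply/funext => i.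
by rewrite addrA subrK.
Qed.

Canonical ultra_equiv := EquivRel ultra_eq ultra_eq_refl ultra_eq_sym ultra_eq_trans.

Definition ultrapower := {eq_quot ultra_equiv}.
HB.instance Definition _ := Choice.on ultrapower.
HB.instance Definition _ := EqQuotient.on ultrapower.

Definition ultraclass (x : linfty) : ultrapower := \pi_ultrapower x.

Fact ultraclassP (x y : linfty) :
  ultraclass x = ultraclass y <-> unull (fun i => x i - y i).
Proof.
split; first by move/eqmodP/asboolP.
by move=> h; apply/eqmodP/asboolP.
Qed.

Fact ultraclassK (p : ultrapower) : ultraclass (repr p) = p.
Proof. exact: reprK. Qed.

Fact ultraclassW (P : ultrapower -> Prop) :
  (forall x, P (ultraclass x)) -> forall p, P p.
Proof. by move=> h p; rewrite -(ultraclassK p). Qed.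

Fact repr_ultraclass x : unull (fun i => repr (ultraclass x) i - x i).
Proof. by apply/ultraclassP; rewrite ultraclassK. Qed.

Implicit Types (p q : ultrapower) (x y z : linfty) (a b : R[i]).

Definition uzero := ultraclass (lcst 0).
Definition uone := ultraclass (lcst 1).
Definition uadd p q := ultraclass (ladd (repr p) (repr q)).
Definition uopp p := ultraclass (lopp (repr p)).
Definition umul p q := ultraclass (lmul (repr p) (repr q)).
Definition uscale a p := ultraclass (lscale a (repr p)).
Definition ustar p := ultraclass (lstar (repr p)).

Fact uaddE x y : uadd (ultraclass x) (ultraclass y) = ultraclass (ladd x y).
Proof.
apply/ultraclassP; move: (unullD (repr_ultraclass x) (repr_ultraclass y)).
by congr unull; apply/funext => i /=; rewrite opprD addrACA.
Qed.

Fact uoppE x : uopp (ultraclass x) = ultraclass (lopp x).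
Proof.
apply/ultraclassP; move: (unullN (repr_ultraclass x)).
by congr unull; apply/funext => i /=; rewrite opprB opprK addrC.
Qed.

Fact umulE x y : umul (ultraclass x) (ultraclass y) = ultraclass (lmul x y).
Proof.
apply/ultraclassP.
move: (unullD (unullMr y (repr_ultraclass x))
  (unullMl (repr (ultraclass x)) (repr_ultraclass y))).
congr unull; apply/funext => i /=.
by rewrite mulrBl mulrBr addrC addrA subrK.
Qed.

Fact uscaleE a x : uscale a (ultraclass x) = ultraclass (lscale a x).
Proof.
apply/ultraclassP; move: (unullMl (lscale a (lcst 1)) (repr_ultraclass x)).
by congr unull; apply/funext => i /=; rewrite -scalerAl mul1r scalerBr.
Qed.

Fact ustarE x : ustar (ultraclass x) = ultraclass (lstar x).
Proof.
apply/ultraclassP; move: (unull_star (repr_ultraclass x)).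
by congr unull; apply/funext => i /=; rewrite starB.
Qed.

Local Ltac ultra :=
  rewrite /uzero /uone ?(uaddE, uoppE, umulE, uscaleE, ustarE);
  congr ultraclass; apply: linfty_ext => i /=.

Fact uaddA : associative uadd.
Proof.
elim/ultraclassW=> x; elim/ultraclassW=> y; elim/ultraclassW=> z.
ultra; exact: addrA.
Qed.
Fact uaddC : commutative uadd.
Proof.
elim/ultraclassW=> x; elim/ultraclassW=> y; ultra; exact: addrC.
Qed.
Fact uadd0 : left_id uzero uadd.
Proof.
elim/ultraclassW=> x; ultra; exact: add0r.
Qed.
Fact uaddN : left_inverse uzero uopp uadd.
Proof.
elim/ultraclassW=> x; ultra; exact: addNr.
Qed.
HB.instance Definition _ :=
  GRing.isZmodule.Build ultrapower uaddA uaddC uadd0 uaddN.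

Fact umulA : associative umul.
Proof.
elim/ultraclassW=> x; elim/ultraclassW=> y; elim/ultraclassW=> z.
ultra; exact: mulrA.
Qed.
Fact umul1l : left_id uone umul.
Proof.
elim/ultraclassW=> x; ultra; exact: mul1r.
Qed.
Fact umul1r : right_id uone umul.
Proof.
elim/ultraclassW=> x; ultra; exact: mulr1.
Qed.
Fact umulDl : left_distributive umul uadd.
Proof.
elim/ultraclassW=> x; elim/ultraclassW=> y; elim/ultraclassW=> z.
ultra; exact: mulrDl.
Qed.
Fact umulDr : right_distributive umul uadd.
Proof.
elim/ultraclassW=> x; elim/ultraclassW=> y; elim/ultraclassW=> z.
ultra; exact: mulrDr.
Qed.
Fact uone_neq0 : uone != uzero.
Proof.
apply/eqP => /ultraclassP /unullP /=.
rewrite /sqnorm2 subr0 star1 mulr1 trace1 /= => h.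
have E : (1 : R) = 0 by apply: (cvg_unique _ (cvg_cst (1 : R)) h); exact: Rhausdorff.
by have /eqP := oner_neq0 R; rewrite E.
Qed.
HB.instance Definition _ := GRing.Zmodule_isNzRing.Build ultrapower
  umulA umul1l umul1r umulDl umulDr uone_neq0.

Fact uscaleA a b p : uscale a (uscale b p) = uscale (a * b) p.
Proof. by elim/ultraclassW: p => x; ultra; exact: scalerA. Qed.
Fact uscale1 : left_id 1 uscale.
Proof.
elim/ultraclassW=> x; ultra; exact: scale1r.
Qed.
Fact uscaleDr : right_distributive uscale +%R.
Proof.
move=> a; elim/ultraclassW=> x; elim/ultraclassW=> y; rewrite /GRing.add /=.
ultra; exact: scalerDr.
Qed.
Fact uscaleDl p : {morph uscale^~ p : a b / a + b}.
Proof.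
elim/ultraclassW: p => x a b; rewrite [in RHS]/GRing.add /=.
by ultra; exact: scalerDl.
Qed.
HB.instance Definition _ := GRing.Zmodule_isLmodule.Build R[i] ultrapower
  uscaleA uscale1 uscaleDr uscaleDl.

Fact uscaleAl (a : R[i]) (p q : ultrapower) : a *: (p * q) = (a *: p) * q.
Proof.
elim/ultraclassW: p => x; elim/ultraclassW: q => y.
by rewrite /GRing.scale /GRing.mul /=; ultra; exact: scalerAl.
Qed.
HB.instance Definition _ := GRing.Lmodule_isLalgebra.Build R[i] ultrapower uscaleAl.
Fact uscaleAr (a : R[i]) (p q : ultrapower) : a *: (p * q) = p * (a *: q).
Proof.
elim/ultraclassW: p => x; elim/ultraclassW: q => y.
by rewrite /GRing.scale /GRing.mul /=; ultra; exact: scalerAr.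
Qed.
HB.instance Definition _ := GRing.Lalgebra_isAlgebra.Build R[i] ultrapower uscaleAr.

Fact ustarK : involutive ustar.
Proof.
elim/ultraclassW=> x; ultra; exact: starK.
Qed.
Fact ustarD : {morph ustar : p q / p + q}.
Proof.
elim/ultraclassW=> x; elim/ultraclassW=> y; rewrite /GRing.add /=.
ultra; exact: starD.
Qed.
Fact ustarZ (a : R[i]) (p : ultrapower) : ustar (a *: p) = a^* *: ustar p.
Proof.
elim/ultraclassW: p => x; rewrite /GRing.scale /=; ultra; exact: starZ.
Qed.
Fact ustarM (p q : ultrapower) : ustar (p * q) = ustar q * ustar p.
Proof.
elim/ultraclassW: p => x; elim/ultraclassW: q => y; rewrite /GRing.mul /=.
ultra; exact: starM.
Qed.
HB.instance Definition _ := Algebra_isStar.Build R ultrapower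
  ustarK ustarD ustarZ ustarM.

(* The limit along U of the traces of a family; it exists when the family is
   bounded, see [ucvg_lim]. *)
Definition ctrace_lim (x : I -> M) : R[i] :=
  lim ((fun i => complex.Re (trace (x i))) @ ultra_sets U) +i*
  lim ((fun i => complex.Im (trace (x i))) @ ultra_sets U).

Definition utrace p := ctrace_lim (repr p).

Definition ucvg (x : I -> M) (c : R[i]) :=
  (fun i => complex.Re (trace (x i))) @ ultra_sets U --> complex.Re c /\
  (fun i => complex.Im (trace (x i))) @ ultra_sets U --> complex.Im c.

Fact Re_trace_le (z : M) : `|complex.Re (trace z)| <= norm2 z.
Proof.
rewrite -sqrtr_sqr ler_sqrt ?sqnorm2_ge0//; apply: le_trans (trace_bound z).
by rewrite lerDl sqr_ge0.
Qed.

Fact Im_trace_le (z : M) : `|complex.Im (trace z)| <= norm2 z.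
Proof.
rewrite -sqrtr_sqr ler_sqrt ?sqnorm2_ge0//; apply: le_trans (trace_bound z).
by rewrite lerDr sqr_ge0.
Qed.

Fact ucvg_lim x : ucvg x (ctrace_lim x).
Proof.
have [K K0 hx] := uniformly_bounded_gt0 (linfty_bounded x).
have xK i : norm2 (x i) <= K.
  rewrite -ler_sqr ?nnegrE ?sqrtr_ge0 ?(ltW K0)// norm2_sqr.
  exact: sqnorm2_le.
split; apply: (@bounded_ultra_cvg _ _ _ _ K) => i; apply: le_trans (xK i).
  exact: Re_trace_le.
exact: Im_trace_le.
Qed.

Fact ucvg_unique (x : I -> M) a b : ucvg x a -> ucvg x b -> a = b.
Proof.
case: a b => [a a'] [b b'] [/= h h'] [/= k k'].
congr Complex.
  by apply: (cvg_unique _ h k); exact: Rhausdorff.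
by apply: (cvg_unique _ h' k'); exact: Rhausdorff.
Qed.

Fact ucvgD (x y : I -> M) a b :
  ucvg x a -> ucvg y b -> ucvg (fun i => x i + y i) (a + b).
Proof.
move=> [h h'] [k k']; split.
  by under eq_fun do rewrite traceD raddfD /=; rewrite raddfD /=; exact: cvgD.
by under eq_fun do rewrite traceD raddfD /=; rewrite raddfD /=; exact: cvgD.
Qed.

Fact ucvgZ (x : I -> M) a c : ucvg x a -> ucvg (fun i => c *: x i) (c * a).
Proof.
case: c a => [c c'] [a a'] [/= h h']; split => /=.
  rewrite (_ : (fun i => _) = fun i =>
    c * complex.Re (trace (x i)) - c' * complex.Im (trace (x i))).
    by apply: cvgB; apply: cvgMl_tmp.
  by apply/funext => i; rewrite traceZ; case: (trace _).
rewrite (_ : (fun i => _) = fun i =>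
    c * complex.Im (trace (x i)) + c' * complex.Re (trace (x i))).
  by apply: cvgD; apply: cvgMl_tmp.
by apply/funext => i; rewrite traceZ; case: (trace _).
Qed.

Fact ucvg_null (x : I -> M) : unull x -> ucvg x 0.
Proof.
move=> h; split; apply: norm_cvg0.
  apply: (squeeze_cvgr _ (cvg_cst 0) h); apply: nearW => i.
  by rewrite normr_ge0 Re_trace_le.
apply: (squeeze_cvgr _ (cvg_cst 0) h); apply: nearW => i.
by rewrite normr_ge0 Im_trace_le.
Qed.

Fact ucvg_trace (x y : I -> M) a :
  (forall i, trace (x i) = trace (y i)) -> ucvg x a -> ucvg y a.
Proof. by move=> xy [h k]; split; under eq_fun do rewrite -xy. Qed.

Fact ucvg_eq (x y : I -> M) a : x =1 y -> ucvg x a -> ucvg y a.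
Proof. by move=> /funext ->. Qed.

Fact utrace_cvg x : ucvg x (utrace (ultraclass x)).
Proof.
have h := ucvgD (ucvg_null (unullN (repr_ultraclass x)))
  (ucvg_lim (repr (ultraclass x))).
rewrite add0r in h; apply: ucvg_eq h => i /=.
by rewrite opprB subrK.
Qed.

Fact utraceP x a : ucvg x a -> utrace (ultraclass x) = a.
Proof. exact/ucvg_unique/utrace_cvg. Qed.

Fact utrace_linear a p q : utrace (a *: p + q) = a * utrace p + utrace q.
Proof.
elim/ultraclassW: p => x; elim/ultraclassW: q => y.
rewrite /GRing.scale /GRing.add /= uscaleE uaddE.
by apply: utraceP; apply: ucvgD (utrace_cvg y); apply: ucvgZ; exact: utrace_cvg.
Qed.

Fact utrace1 : utrace 1 = 1.
Proof.
apply: utraceP; split => /=.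
  by rewrite trace1; exact: cvg_cst.
by rewrite trace1; exact: cvg_cst.
Qed.

Fact utraceC p q : utrace (p * q) = utrace (q * p).
Proof.
elim/ultraclassW: p => x; elim/ultraclassW: q => y.
rewrite /GRing.mul /= !umulE; apply: utraceP.
by apply: ucvg_trace (utrace_cvg (lmul y x)) => i; exact: traceC.
Qed.

Fact utrace_sqnorm2 x :
  ucvg (fun i => star (x i) * x i) (utrace (ustar (ultraclass x) * ultraclass x)).
Proof.
by rewrite ustarE /GRing.mul /= umulE; exact: (utrace_cvg (lmul (lstar x) x)).
Qed.

Fact utrace_ge0 p : 0 <= utrace (star p * p).
Proof.
elim/ultraclassW: p => x; have [h k] := utrace_sqnorm2 x.
rewrite lecE; apply/andP; split => /=.
  apply/eqP; apply: (cvg_unique _ k); first exact: Rhausdorff.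
  rewrite (_ : (fun i => _) = fun=> 0); first exact: cvg_cst.
  by apply/funext => i; have /= := traceE2 (x i) => ->.
apply: (closed_cvg (fun r : R => 0 <= r) _ _ _ h); first exact: closed_ge.
by apply: nearW => i; exact: sqnorm2_ge0.
Qed.

Fact utrace_eq0 p : utrace (star p * p) = 0 -> p = 0.
Proof.
elim/ultraclassW: p => x; have [h _] := utrace_sqnorm2 x.
rewrite /= => E; apply/ultraclassP/unullP; move: h; rewrite E.
by under [in X in _ -> X]eq_fun do rewrite subr0.
Qed.

HB.instance Definition _ := StarAlgebra_isTracial.Build R ultrapower
  utrace_linear utrace1 utraceC utrace_ge0 utrace_eq0.

(* The diagonal embedding. *)
Definition diag (x : M) : ultrapower := ultraclass (lcst x).

(* p is the class of the family x. This includes that x is bounded, which is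
   automatic when x i is the image of a fixed element under a unital
   *-homomorphism. *)
Definition represents (x : I -> M) (p : ultrapower) :=
  exists2 y : linfty, y =1 x & p = ultraclass y.

End Ultrapower.

Arguments ultrapower {R} M {I} U.

Section Properties.
Context {R : realType}.

Definition star_morphism (A B : starAlgType R) (f : {lrmorphism A -> B}) :=
  forall x, f (star x) = star (f x).

Definition embedding (A B : tracialStarAlgType R) (f : {lrmorphism A -> B}) :=
  star_morphism f /\ forall x, trace (f x) = trace x.

Definition unitary (A : starAlgType R) (u : A) :=
  star u * u = 1 /\ u * star u = 1.

Implicit Type M : tracialVNType R.

Definition separable M :=
  exists d : nat -> M, forall (x : M) (e : R), 0 < e ->
    exists n, norm2 (x - d n) < e.

Definition factor M :=
  forall z : M, (forall x : M, z * x = x * z) -> exists c : R[i], z = c%:A.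

Definition finite_dimensional M :=
  exists (n : nat) (b : 'I_n -> M), forall x : M,
    exists c : 'I_n -> R[i], x = \sum_(k < n) c k *: b k.

(* A II_1 factor is an infinite-dimensional factor carrying a faithful normal
   tracial state; the latter is part of M. *)
Definition II1_factor M := factor M /\ ~ finite_dimensional M.

(* An inclusion of M in N is given as an embedding j of M in N. *)
Definition existentially_closed M :=
  forall (N : tracialVNType R) (j : {lrmorphism M -> N}), embedding j ->
    exists (I : Type) (U : ultrafilter I)
      (g : {lrmorphism N -> ultrapower M U}),
      embedding g /\ forall x : M, g (j x) = diag U x.

Definition self_tracially_stable M :=
  forall U : ultrafilter nat, nonprincipal U ->
  forall f : {lrmorphism M -> ultrapower M U}, embedding f ->
    exists f_ : nat -> {lrmorphism M -> M},
      (forall i, star_morphism (f_ i)) /\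
      forall x : M, represents (fun i => f_ i x) (f x).

Definition jung_property M :=
  forall U : ultrafilter nat, nonprincipal U ->
  forall f : {lrmorphism M -> ultrapower M U}, embedding f ->
    exists u : ultrapower M U,
      unitary u /\ forall x : M, u * f x * star u = diag U x.

End Properties.

(* Main.v *)
Require Import Defs.
From HB Require Import structures.
From mathcomp Require Import all_boot all_order all_algebra.
From mathcomp Require Import complex.
From mathcomp Require Import boolp classical_sets reals.
From mathcomp Require Import topology normedtype.
From mathcomp Require Import ring lra.

Set Implicit Arguments.
Unset Strict Implicit.
Unset Printing Implicit Defensive.

Import Order.TTheory GRing.Theory Num.Theory numFieldNormedType.Exports.
Local Open Scope classical_set_scope.
Local Open Scope ring_scope.
Local Open Scope complex_scope.

(** Every trace-preserving endomorphism f of an existentially closed M is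
approximately inner ([approx_inner]); this is where existential closedness enters.
Map M into the (n+1) x (n+1) matrices over M by sending x to the diagonal matrix
j(x) = diag(x, f x, ..., f^n x). The cyclic shift w is a unitary matrix, and
w j(f x) w^* differs from j(x) in a single diagonal entry, so that the square of
their distance in 2-norm is of order 1/n ([shift_orbit]). Existential closedness
maps the matrices into an ultrapower of M in such a way that j(x) goes to the
diagonal image of x. The image of w is a unitary of the ultrapower, which lifts to
a family of contractions of M ([isometry_lift]), and one of them nearly conjugates
f x to x for the finitely many x that were prescribed.

Self-tracial stability presents an embedding of M into its ultrapower as a
sequence of unital *-endomorphisms f_i. The composition of the trace with f_i is a
tracial state that is not known to be normal, but a factor has only one tracial
state at all ([unique_trace]), so f_i preserves the trace. Choosing v_i that
conjugates f_i, up to 1/(i+1), to the identity on the first terms of a dense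
sequence yields the unitary (v_i) of the ultrapower.

Two pieces of theory support this argument. For [unique_trace], polar
decompositions ([polar]) are strong limits of a polynomial Newton iteration, whose
positivity and monotonicity are read off from polynomials in X and 1 - X with
nonnegative coefficients ([cone_pos]); exhaustion by partial isometries
([exhaustion]) then gives the comparison of projections ([comparison]). Two tracial
states agree on projections by a Euclidean algorithm on traces ([halving]), and on
all operators by dyadic expansion ([dyadic_step]). Secondly, the matrices over M
are a tracial von Neumann algebra; the normality of their trace reduces to that of
the trace of M, because suprema of directed families are strong limits
([directed_sup_form]) and can therefore be taken entry by entry. *)

(** * Hilbert spaces *)

Section RealInnerProduct.
Context {R : realType} {H : hilbertType R}.
Implicit Types (u v w : H) (c : R).

(** The real inner product; it determines the complex one by [ip_rip], so that
all estimates can be made in R. *)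
Definition rip v w : R := complex.Re (ip v w).

Lemma ripDl u v w : rip (u + v) w = rip u w + rip v w.
Proof. by rewrite /rip ipDl raddfD. Qed.
Lemma ripDr u v w : rip w (u + v) = rip w u + rip w v.
Proof. by rewrite /rip ipDr raddfD. Qed.
Lemma ripC v w : rip v w = rip w v.
Proof. by rewrite /rip ipC; case: (ip w v). Qed.
Lemma ripNl v w : rip (- v) w = - rip v w.
Proof. by rewrite /rip ipNl raddfN. Qed.
Lemma ripNr v w : rip w (- v) = - rip w v.
Proof. by rewrite ripC ripNl ripC. Qed.
Lemma ripBl u v w : rip (u - v) w = rip u w - rip v w.
Proof. by rewrite ripDl ripNl. Qed.
Lemma ripBr u v w : rip w (u - v) = rip w u - rip w v.
Proof. by rewrite ripDr ripNr. Qed.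
Lemma ripZl c v w : rip (c%:C *: v) w = c * rip v w.
Proof. by rewrite /rip ipZl; case: (ip v w) => a b /=; rewrite mul0r subr0. Qed.
Lemma ripZr c v w : rip w (c%:C *: v) = c * rip w v.
Proof. by rewrite ripC ripZl ripC. Qed.
Lemma rip0l w : rip 0 w = 0.
Proof. by rewrite /rip ip0l. Qed.
Lemma rip0r w : rip w 0 = 0.
Proof. by rewrite ripC rip0l. Qed.
Lemma rip_hnorm v : rip v v = hnorm v ^+ 2.
Proof. by rewrite /rip ip_hnorm. Qed.
Lemma ip_rip v w : ip v w = rip v w +i* rip v ('i *: w).
Proof.
rewrite /rip ipZr; case: (ip v w) => a b /=; congr Complex.
by rewrite mul0r sub0r mulN1r opprK.
Qed.

Lemma hnorm0 : hnorm (0 : H) = 0.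
Proof. by rewrite /hnorm normr0. Qed.
Lemma hnorm_opp v : hnorm (- v) = hnorm v.
Proof. by rewrite /hnorm normrN. Qed.
Lemma hnorm_eq0 v : hnorm v = 0 -> v = 0.
Proof. by move=> h; apply/eqP; rewrite -normr_eq0 hnormE h. Qed.
Lemma ler_hnormD v w : hnorm (v + w) <= hnorm v + hnorm w.
Proof.
have := ler_normD v w; rewrite !hnormE -(rmorphD (real_complex R)).
by rewrite lecR.
Qed.
Lemma hnormZ c v : hnorm (c%:C *: v) = `|c| * hnorm v.
Proof.
apply/eqP; rewrite -(@eqrXn2 _ 2)// ?mulr_ge0 ?hnorm_ge0//; apply/eqP.
by rewrite -rip_hnorm ripZl ripZr rip_hnorm exprMn real_normK ?num_real// mulrA.
Qed.
Lemma hnorm_sub v w : hnorm (v - w) = hnorm (w - v).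
Proof. by rewrite -hnorm_opp opprB. Qed.

Lemma rip_ext v w : (forall u, rip v u = rip w u) -> v = w.
Proof.
move=> h; apply/eqP; rewrite -subr_eq0; apply/eqP/hnorm_eq0.
apply/eqP; rewrite -sqrf_eq0 -rip_hnorm ripBl; apply/eqP.
by rewrite h subrr.
Qed.

Lemma rip_CS v w : `|rip v w| <= hnorm v * hnorm w.
Proof.
have [->|w0] := eqVneq w 0; first by rewrite rip0r normr0 hnorm0 mulr0.
have nw : 0 < hnorm w ^+ 2.
  rewrite exprn_gt0// lt_neqAle hnorm_ge0 andbT eq_sym.
  by apply: contra_neq w0; exact: hnorm_eq0.
rewrite -ler_sqr ?nnegrE ?mulr_ge0 ?hnorm_ge0//.
rewrite real_normK ?num_real// exprMn.
set t := rip v w / hnorm w ^+ 2.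
have : 0 <= hnorm (v - t%:C *: w) ^+ 2 by rewrite sqr_ge0.
rewrite -rip_hnorm ripBl !ripBr !ripZl !ripZr !rip_hnorm (ripC w v).
have E : t * hnorm w ^+ 2 = rip v w by rewrite /t divfK ?gt_eqF.
rewrite E subrr subr0 subr_ge0 -(ler_pM2r nw) => h.
by apply: le_trans h; rewrite mulrAC E expr2.
Qed.

End RealInnerProduct.

Section HConvergence.
Context {R : realType} {H : hilbertType R} {T : Type} (F : set_system T).
Context {PF : ProperFilter F}.
Implicit Types (f g : T -> H) (l : H).

(** Convergence in norm, expressed with real rather than complex radii. *)
Definition hcvg f l := forall e : R, 0 < e -> \forall t \near F, hnorm (l - f t) < e.

Lemma complex_gt0 (e : R[i]) : 0 < e -> 0 < complex.Re e /\ e = (complex.Re e)%:C.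
Proof. by rewrite ltcE; case: e => a b /= /andP[/eqP -> ->]. Qed.

Lemma hcvgP f l : f @ F --> l <-> hcvg f l.
Proof.
split=> h.
  move=> e e0; have e0' : (0 : R[i]) < e%:C by rewrite ltcR.
  have /cvgrPdist_lt /(_ _ e0') := h; apply: filterS => t.
  by rewrite hnormE ltcR.
apply/cvgrPdist_lt => e /complex_gt0[e0 ->]; have := h _ e0; apply: filterS => t.
by rewrite hnormE ltcR.
Qed.

Lemma hcvg_complete f :
  (forall e : R, 0 < e -> exists l, \forall t \near F, hnorm (l - f t) < e) ->
  exists l, hcvg f l.
Proof.
move=> h; have : cvg (f @ F).
  apply: cauchy_cvg; apply: cauchy_exP => e /complex_gt0[e0 ->].
  have [l hl] := h _ e0; exists l; rewrite /= nbhs_simpl; apply: filterS hl => t.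
  by rewrite -ball_normE /= hnormE ltcR.
by move=> /cvg_ex[l hl]; exists l; apply/hcvgP.
Qed.

Lemma hcvg_cst l : hcvg (fun=> l) l.
Proof. by move=> e e0; apply: nearW => t; rewrite subrr hnorm0. Qed.

Lemma hcvgD f g l m : hcvg f l -> hcvg g m -> hcvg (fun t => f t + g t) (l + m).
Proof.
move=> hf hg e e0; have e2 : 0 < e / 2 by rewrite divr_gt0.
apply: filterS2 (hf _ e2) (hg _ e2) => t hl hm.
rewrite opprD addrACA [ltRHS]splitr.
by apply: le_lt_trans (ler_hnormD _ _) _; exact: ltrD.
Qed.

Lemma hcvg_lipschitz (H' : hilbertType R) (f : T -> H) (f' : T -> H') (l : H) (l' : H') (K : R) :
  (\forall t \near F, hnorm (l' - f' t) <= K * hnorm (l - f t)) ->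
  hcvg f l -> forall e : R, 0 < e -> \forall t \near F, hnorm (l' - f' t) < e.
Proof.
move=> h hf e e0.
have K1 : 0 < `|K| + 1 by rewrite ltr_pwDr.
have e1 : 0 < e / (`|K| + 1) by rewrite divr_gt0.
apply: filterS2 (hf _ e1) h => t hl /le_lt_trans; apply.
move: hl; rewrite ltr_pdivlMr// mulrC => hl.
apply: le_lt_trans hl; rewrite ler_wpM2r ?hnorm_ge0//.
by apply: le_trans (ler_norm _) _; rewrite lerDl.
Qed.

Lemma hcvgN f l : hcvg f l -> hcvg (fun t => - f t) (- l).
Proof.
move=> hf e e0; apply: filterS (hf _ e0) => t.
by rewrite -opprD hnorm_opp.
Qed.

Lemma rip_cvg f l w : hcvg f l -> (fun t => rip (f t) w) @ F --> rip l w.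
Proof.
move=> hf; apply/cvgrPdist_lt => e e0.
have w1 : 0 < hnorm w + 1 by rewrite ltr_wpDl ?hnorm_ge0.
have e1 : 0 < e / (hnorm w + 1) by rewrite divr_gt0.
apply: filterS (hf _ e1) => t; rewrite ltr_pdivlMr// -ripBl.
apply: le_lt_trans; apply: le_trans (rip_CS _ _) _.
by rewrite ler_wpM2l ?hnorm_ge0// lerDl.
Qed.

Lemma hcvg_unique f l m : hcvg f l -> hcvg f m -> l = m.
Proof.
move=> /rip_cvg hl /rip_cvg hm; apply: rip_ext => u.
by apply: (cvg_unique _ (hl u) (hm u)); exact: Rhausdorff.
Qed.

Lemma hcvg_sqnorm f l : hcvg f l ->
  (fun t => hnorm (f t) ^+ 2) @ F --> hnorm l ^+ 2.
Proof.
move=> hf; rewrite expr2; under eq_fun do rewrite expr2.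
suff h : (fun t => hnorm (f t)) @ F --> hnorm l by exact: cvgM.
apply/cvgrPdist_lt => e e0; apply: filterS (hf _ e0) => t; apply: le_lt_trans.
rewrite ler_norml; apply/andP; split.
  rewrite lerNl opprB lerBlDr hnorm_sub; apply: le_trans (ler_hnormD _ _).
  by rewrite subrK.
rewrite lerBlDr; apply: le_trans (ler_hnormD _ _).
by rewrite subrK.
Qed.

Lemma hcvg_near_eq f g l : hcvg f l -> (\forall t \near F, f t = g t) -> hcvg g l.
Proof. by move=> hf fg e e0; apply: filterS2 (hf e e0) fg => t ? <-. Qed.

End HConvergence.

Section BoundedLinear.
Context {R : realType}.

Lemma hnorm_sum (H1 : hilbertType R) (I : finType) (f : I -> H1) :
  hnorm (\sum_i f i) <= \sum_i hnorm (f i).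
Proof.
elim/big_ind2: _ => [|x a y b h k|//]; first by rewrite hnorm0.
by apply: le_trans (ler_hnormD _ _) _; exact: lerD.
Qed.

Lemma ip_sumr (H1 : hilbertType R) (I : finType) (f : I -> H1) w :
  ip w (\sum_i f i) = \sum_i ip w (f i).
Proof.
apply: (big_morph (ip w)) => [x y|]; first exact: ipDr.
by rewrite ipC ip0l conjc0.
Qed.

Lemma ip_suml (H1 : hilbertType R) (I : finType) (f : I -> H1) w :
  ip (\sum_i f i) w = \sum_i ip (f i) w.
Proof. by apply: (big_morph (ip^~ w)) => [x y|]; [exact: ipDl|exact: ip0l]. Qed.

Lemma bounded_continuous (H1 H2 : hilbertType R) (f : {linear H1 -> H2}) (K : R) :
  (forall v, hnorm (f v) <= K * hnorm v) -> continuous f.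
Proof.
move=> hK; apply/linear_bounded_continuous/linear_boundedP.
near=> C => v; rewrite !hnormE; apply: (@le_trans _ _ (`|K|%:C * (hnorm v)%:C)).
  rewrite -(rmorphM (real_complex R)) lecR; apply: le_trans (hK v) _.
  by rewrite ler_wpM2r ?hnorm_ge0// ler_norm.
rewrite ler_wpM2r ?(lecR 0) ?hnorm_ge0//.
by near: C; apply: nbhs_pinfty_ge; rewrite ger0_real// (lecR 0) normr_ge0.
Unshelve. all: by end_near. Qed.

Lemma continuous_bounded (H1 H2 : hilbertType R) (f : {linear H1 -> H2}) :
  continuous f -> exists K : R, forall v, hnorm (f v) <= K * hnorm v.
Proof.
move=> fc; have /linear_boundedP := @continuous_linear_bounded _ _ _ 0 f (fc 0).
move=> /pinfty_ex_gt0[K K0 h]; have [_ KE] := complex_gt0 K0.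
exists (complex.Re K) => v; have := h v.
by rewrite !hnormE KE -(rmorphM (real_complex R)) lecR.
Qed.

End BoundedLinear.

(** * Strong limits in a von Neumann algebra *)

Section StarLemmas.
Context {R : realType} {A : starAlgType R}.
Implicit Types (x y : A).
Lemma star_0 : star (0 : A) = 0.
Proof. by apply: (addIr (star 0)); rewrite -starD !add0r. Qed.
Lemma star_N x : star (- x) = - star x.
Proof. by apply: (addIr (star x)); rewrite -starD !addNr star_0. Qed.
Lemma star_B x y : star (x - y) = star x - star y.
Proof. by rewrite starD star_N. Qed.
Lemma star_1 : star (1 : A) = 1.
Proof. by rewrite -[LHS]mulr1 -{2}[1 : A]starK -starM mulr1 starK. Qed.
Lemma star_Zr (c : R) x : star (c%:C *: x) = c%:C *: star x.
Proof. by rewrite starZ; congr (_ *: _); exact: conjc_real. Qed.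
End StarLemmas.

Section StrongConvergence.
Context {R : realType} {N : vonNeumannType R}.
Implicit Types (x y z : N) (v w : vnspace N) (K : R).

Lemma repB x y v : rep (x - y) v = rep x v - rep y v.
Proof. by rewrite repD repN. Qed.

Lemma rip_star x v w : rip (rep (star x) v) w = rip v (rep x w).
Proof. by rewrite /rip rep_star. Qed.

Lemma rep_ext x y : (forall v w, rip (rep x v) w = rip (rep y v) w) -> x = y.
Proof.
move=> h; apply/eqP; rewrite -subr_eq0; apply/eqP/rep_inj => v.
by apply: rip_ext => u; rewrite repB ripBl h subrr rip0l.
Qed.

Context {T : Type} (F : set_system T) {PF : ProperFilter F}.

Definition scvg (x : T -> N) y := forall v, hcvg F (fun t => rep (x t) v) (rep y v).

Lemma hcvg_rep x (f : T -> vnspace N) l :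
  hcvg F f l -> hcvg F (fun t => rep x (f t)) (rep x l).
Proof.
move=> hf; have [K K0 /op_boundedP hK] := op_bounded_exists x.
apply: (hcvg_lipschitz (K := K) _ hf); apply: nearW => t.
by rewrite -linearB; exact: hK.
Qed.

Lemma scvg_cst x : scvg (fun=> x) x.
Proof. by move=> v; exact: hcvg_cst. Qed.

Lemma scvgD (x y : T -> N) a b :
  scvg x a -> scvg y b -> scvg (fun t => x t + y t) (a + b).
Proof.
move=> h k v; rewrite repD; under [X in hcvg F X _]funext => t do rewrite repD.
exact: hcvgD.
Qed.

Lemma scvgN (x : T -> N) a : scvg x a -> scvg (fun t => - x t) (- a).
Proof.
move=> h v; rewrite repN; under [X in hcvg F X _]funext => t do rewrite repN.
exact: hcvgN.
Qed.

Lemma scvgB (x y : T -> N) a b :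
  scvg x a -> scvg y b -> scvg (fun t => x t - y t) (a - b).
Proof. by move=> h k; apply: scvgD => //; exact: scvgN. Qed.

Lemma scvg_mull z (x : T -> N) a : scvg x a -> scvg (fun t => z * x t) (z * a).
Proof.
move=> h v; rewrite repM; under [X in hcvg F X _]funext => t do rewrite repM.
exact/hcvg_rep/h.
Qed.

Lemma scvg_mulr z (x : T -> N) a : scvg x a -> scvg (fun t => x t * z) (a * z).
Proof.
move=> h v; rewrite repM; under [X in hcvg F X _]funext => t do rewrite repM.
exact: h.
Qed.

Lemma scvgM K (x y : T -> N) a b : (forall t, op_bounded K (x t)) ->
  scvg x a -> scvg y b -> scvg (fun t => x t * y t) (a * b).
Proof.
move=> hK hx hy v; rewrite -[rep (a * b) v]addr0.
rewrite (_ : (fun t => _) = fun t =>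
    rep (x t * b) v + (rep (x t) (rep (y t) v - rep b v))); last first.
  by apply/funext => t; rewrite linearB !repM /= addrC subrK.
apply: hcvgD; first exact: scvg_mulr.
have : hcvg F (fun t => rep (y t) v - rep b v) 0.
  by rewrite -(subrr (rep b v)); apply: hcvgD (hy v) _; exact: hcvg_cst.
apply: (hcvg_lipschitz (K := K)); apply: nearW => t.
by rewrite !sub0r !hnorm_opp; have /op_boundedP := hK t; apply.
Qed.

Lemma scvg_rip (x : T -> N) a v w : scvg x a ->
  (fun t => rip (rep (x t) v) w) @ F --> rip (rep a v) w.
Proof. by move=> h; apply: rip_cvg; exact: h. Qed.

Lemma scvg_unique (x : T -> N) a b : scvg x a -> scvg x b -> a = b.
Proof.
move=> h k; apply: rep_ext => v w; congr rip.
exact: hcvg_unique (h v) (k v).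
Qed.

Lemma eq_scvg (x y : T -> N) a : x =1 y -> scvg x a -> scvg y a.
Proof. by move=> /funext ->. Qed.

Lemma scvg_star_eq (x y : T -> N) a b : (forall t, star (x t) = y t) ->
  scvg x a -> scvg y b -> star a = b.
Proof.
move=> xy hx hy; apply: rep_ext => v w; rewrite rip_star ripC.
apply: (cvg_unique _ (scvg_rip (v := w) (w := v) hx)); first exact: Rhausdorff.
apply: cvg_trans (scvg_rip (v := v) (w := w) hy).
by under [X in nbhs (X @ F)]eq_fun do rewrite -xy rip_star ripC; exact: cvg_id.
Qed.

(** The pointwise limit is a bounded operator, and it belongs to the algebra
because it is in particular a limit in the weak operator topology. *)
Lemma strong_limit K (x : T -> N) : (\forall t \near F, op_bounded K (x t)) ->
  (forall v (e : R), 0 < e ->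
     exists l, \forall t \near F, hnorm (l - rep (x t) v) < e) ->
  exists y, scvg x y.
Proof.
move=> hK hx.
have /choice[f hf] : forall v, exists l, hcvg F (fun t => rep (x t) v) l.
  by move=> v; apply: hcvg_complete; exact: hx.
have f_lin : linear f.
  move=> a v w; apply: (hcvg_unique (hf _)).
  under [X in hcvg F X _]funext => t do rewrite linearP.
  apply: hcvgD => //.
  apply: (hcvg_lipschitz (K := complex.Re `|a|) _ (hf v)); apply: nearW => t.
  rewrite -scalerBr -lecR rmorphM /= -!hnormE normrZ.
  have -> // : (complex.Re `|a|)%:C = `|a|.
  by have := normr_ge0 a; rewrite lecE; case: (`|a|) => ? ? /= /andP[/eqP ->].
pose fl : {linear vnspace N -> vnspace N} :=
  HB.pack f (GRing.isLinear.Build _ _ _ _ f f_lin).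
have f_bounded v : hnorm (f v) <= `|K| * hnorm v.
  rewrite -ler_sqr ?nnegrE ?mulr_ge0 ?hnorm_ge0//.
  apply: (closed_cvg (fun r : R => r <= (`|K| * hnorm v) ^+ 2) _ _ _
    (hcvg_sqnorm (hf v))); first exact: closed_le.
  apply: filterS hK => t /op_boundedP /(_ v) h.
  rewrite ler_sqr ?nnegrE ?mulr_ge0 ?hnorm_ge0//; apply: le_trans h _.
  by rewrite ler_wpM2r ?hnorm_ge0// ler_norm.
have f_cont : continuous fl by exact: (@bounded_continuous _ _ _ fl `|K|).
have [y hy] : exists y, forall v, rep y v = fl v.
  apply: (@rep_wot_closed _ _ fl (x @ F)) => [|v w]; first exact: f_cont.
  have hr u : (fun t => rip (rep (x t) v) u) @ F --> rip (f v) u.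
    by apply: rip_cvg; exact: hf.
  apply/cvgrPdist_lt => e e0; have [e0' eE] := complex_gt0 e0.
  have e2 : 0 < complex.Re e / 2 by rewrite divr_gt0.
  have /cvgrPdist_lt /(_ _ e2) h1 := hr w.
  have /cvgrPdist_lt /(_ _ e2) h2 := hr ('i *: w).
  rewrite near_simpl /=; apply: filterS2 h1 h2 => t h1 h2.
  rewrite !ip_rip eE; set a := rip _ _ in h1 *; set b := rip _ _ in h1 *.
  set c := rip _ _ in h2 *; set d := rip _ _ in h2 *.
  have -> : (a +i* c) - (b +i* d) = (a - b)%:C + 'i * (c - d)%:C.
    by simpc.
  apply: le_lt_trans (ler_normD _ _) _; rewrite normrM normCi mul1r.
  have nr (r : R) : `|r%:C| = `|r|%:C by rewrite normc_def /= expr0n addr0 sqrtr_sqr.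
  by rewrite !nr -(rmorphD (real_complex R)) ltcR [ltRHS]splitr ltrD.
by exists y => v; rewrite hy; exact: hf.
Qed.

End StrongConvergence.

(** * Newton's iteration for the inverse square root *)

Section Cone.
Context {R : realType}.
Implicit Types (p q : {poly R[i]}).

(** The nonnegative combinations of the products X^i (1 - X)^j. Membership is a
certificate of positivity on [0, 1] that can be evaluated at an operator between 0
and 1, see [cone_pos]; it takes the place of the spectral theorem. *)
Inductive cone : {poly R[i]} -> Prop :=
| cone0 : cone 0
| cone1 : cone 1
| coneD p q : cone p -> cone q -> cone (p + q)
| coneZ (c : R) p : 0 <= c -> cone p -> cone (c%:C *: p)
| cone_mulX p : cone p -> cone ('X * p)
| cone_mulCX p : cone p -> cone ((1 - 'X) * p).

Lemma coneM p q : cone p -> cone q -> cone (p * q).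
Proof.
move=> hp hq; elim: hp => [||r s _ IHr _ IHs|c r c0 _ IH|r _ IH|r _ IH].
- by rewrite mul0r; exact: cone0.
- by rewrite mul1r.
- by rewrite mulrDl; exact: coneD.
- by rewrite -scalerAl; exact: coneZ.
- by rewrite -mulrA; exact: cone_mulX.
- by rewrite -mulrA; exact: cone_mulCX.
Qed.

Lemma coneX : cone 'X.
Proof. by rewrite -['X]mulr1; apply: cone_mulX; exact: cone1. Qed.
Lemma coneCX : cone (1 - 'X).
Proof. by rewrite -[1 - 'X]mulr1; apply: cone_mulCX; exact: cone1. Qed.

Lemma cone_mono (P : nat -> {poly R[i]}) : (forall k, cone (P k.+1 - P k)) ->
  forall l m, (l <= m)%N -> cone (P m - P l).
Proof.
move=> h l; elim=> [|m IH]; first by rewrite leqn0 => /eqP ->; rewrite subrr; exact: cone0.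
rewrite leq_eqVlt => /orP[/eqP ->|]; first by rewrite subrr; exact: cone0.
by rewrite ltnS => /IH k; rewrite -(subrK (P m) (P m.+1)) -addrA; exact: coneD.
Qed.

(** Newton's iteration Q |-> Q (3 - X Q^2) / 2 for the inverse square root of X. It
uses no inverse, and on [0, 1] it increases from 1. *)
Fixpoint newton k : {poly R[i]} := if k is k'.+1
  then newton k' + (2^-1)%:C *: (newton k' * (1 - 'X * newton k' ^+ 2)) else 1.

(** This sequence increases to the indicator function of ]0, 1]. *)
Definition newton_sq k := 'X * newton k ^+ 2.

Let h : {poly R[i]} := ((2^-1)%:C)%:P.
Let hh : h + h = 1.
Proof.
by rewrite -polyCD -(rmorphD (real_complex R)) -{1}[2^-1]div1r -{2}[2^-1]div1r -splitr.
Qed.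
Let newtonS k : newton k.+1 = newton k * (1 + h * (1 - newton_sq k)).
Proof. by rewrite /= -mul_polyC /newton_sq -/h; ring. Qed.

Lemma newton_sqS k :
  newton_sq k.+1 = newton_sq k * (1 + h * (1 - newton_sq k)) ^+ 2.
Proof. by rewrite /newton_sq newtonS /newton_sq; ring. Qed.

Let coneh p : cone p -> cone (h * p).
Proof. by move=> hp; rewrite mul_polyC; apply: coneZ => //; rewrite invr_ge0. Qed.

Lemma cone_newton k :
  [/\ cone (newton k), cone (newton_sq k) & cone (1 - newton_sq k)].
Proof.
elim: k => [|k [h1 h2 h3]].
  split; first exact: cone1.
    by rewrite /newton_sq expr1n mulr1; exact: coneX.
  by rewrite /newton_sq expr1n mulr1; exact: coneCX.
have hN : cone (newton k.+1).
  by rewrite newtonS; apply: coneM => //; apply: coneD; [exact: cone1|exact: coneh].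
split => //; first by rewrite /newton_sq expr2; apply: coneM; [exact: coneX|exact: coneM].
(* With c = 1 - X Q^2, the next value of c is c^2 (3 + c) / 4. *)
rewrite newton_sqS; set c := 1 - newton_sq k in h3 *.
have -> : newton_sq k = 1 - c by rewrite /c opprB addrC subrK.
have -> : 1 - (1 - c) * (1 + h * c) ^+ 2 =
    h * c * (h * c) * (1 + 1 + 1 + c).
  have cE : c = h * c + h * c by rewrite -mulrDl hh mul1r.
  by move: (h * c) cE => u ->; ring.
have h3' := coneh h3; apply: coneM; first exact: coneM.
by apply: coneD => //; do 2?[apply: coneD; last exact: cone1]; exact: cone1.
Qed.

Lemma cone_newton_mono l m : (l <= m)%N -> cone (newton m - newton l).
Proof.
move=> lm; apply: cone_mono lm => k; have [h1 _ h3] := cone_newton k.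
rewrite newtonS; set c := 1 - newton_sq k in h3 *.
have -> : newton k * (1 + h * c) - newton k = newton k * (h * c) by ring.
by apply: coneM => //; exact: coneh.
Qed.

Lemma cone_newton_sq_mono l m : (l <= m)%N -> cone (newton_sq m - newton_sq l).
Proof.
move=> lm; apply: cone_mono lm => k; have [_ h2 h3] := cone_newton k.
rewrite newton_sqS; set c := 1 - newton_sq k in h3 *.
have -> : newton_sq k * (1 + h * c) ^+ 2 - newton_sq k =
    newton_sq k * ((h + h) * c + h * c * (h * c)) by ring.
rewrite hh mul1r; apply: coneM => //; apply: coneD => //.
by apply: coneM; exact: coneh.
Qed.

(** The difference of the two sides is 2 X Q_l (Q_m - Q_l). At b = y^* y this bounds
the square of the difference of y Q_m and y Q_l by an increment of a bounded
monotone sequence. *)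
Lemma cone_newton_diff l m : (l <= m)%N ->
  cone (newton_sq m - newton_sq l - 'X * (newton m - newton l) ^+ 2).
Proof.
move=> lm; have [h1 _ _] := cone_newton l; have hd := cone_newton_mono lm.
have -> : newton_sq m - newton_sq l - 'X * (newton m - newton l) ^+ 2 =
    'X * newton l * (newton m - newton l) + 'X * newton l * (newton m - newton l).
  by rewrite /newton_sq; ring.
have hx : cone ('X * newton l * (newton m - newton l)).
  by apply: coneM => //; apply: coneM => //; exact: coneX.
exact: coneD.
Qed.

(** This sequence increases to the square root of X. *)
Definition newton_sqrt k := 'X * newton k.

Lemma newton_sqrtS k :
  newton_sqrt k.+1 = newton_sqrt k + (2^-1)%:C *: (newton_sqrt k * (1 - newton_sq k)).
Proof. by rewrite /newton_sqrt newtonS -mul_polyC -/h; ring. Qed.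

Lemma newton_sqrt_sq k : newton_sqrt k * newton_sqrt k = 'X * newton_sq k.
Proof. by rewrite /newton_sqrt /newton_sq; ring. Qed.

Lemma cone_newton_sqrt k : cone (newton_sqrt k) /\ cone (1 - newton_sqrt k).
Proof.
have [h1 h2 h3] := cone_newton k; split; first by apply: coneM => //; exact: coneX.
(* 2 (1 - X Q) = (1 - X) + (1 - X Q^2) + X (Q - 1)^2, and newton 0 = 1. *)
have -> : 1 - newton_sqrt k =
    h * ((1 - 'X) + (1 - newton_sq k) + 'X * (newton k - newton 0) ^+ 2).
  rewrite (_ : newton 0 = 1)// -[LHS]mul1r -{1}hh /newton_sqrt /newton_sq.
  by ring.
apply: coneh; apply: coneD; first by apply: coneD => //; exact: coneCX.
rewrite expr2; have := cone_newton_mono (leq0n k) => hd.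
by apply: coneM; [exact: coneX|exact: coneM].
Qed.

Lemma cone_newton_sqrt_mono l m : (l <= m)%N -> cone (newton_sqrt m - newton_sqrt l).
Proof.
move=> lm; rewrite /newton_sqrt -mulrBr; apply: coneM; first exact: coneX.
exact: cone_newton_mono.
Qed.
End Cone.

(** * Positive operators and their square roots *)

Section Positive.
Context {R : realType} {N : vonNeumannType R}.
Implicit Types (x y z b : N) (v w : vnspace N) (K : R).

Definition pos x := star x = x /\ forall v, 0 <= rip (rep x v) v.

Lemma pos0 : pos 0.
Proof. by split=> [|v]; rewrite ?star_0// rep0 rip0l. Qed.
Lemma pos1 : pos 1.
Proof. by split=> [|v]; rewrite ?star_1// rep1 rip_hnorm sqr_ge0. Qed.
Lemma posD x y : pos x -> pos y -> pos (x + y).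
Proof.
move=> [sx px] [sy py]; split=> [|v]; first by rewrite starD sx sy.
by rewrite repD ripDl addr_ge0.
Qed.
Lemma posZ (c : R) x : 0 <= c -> pos x -> pos (c%:C *: x).
Proof.
move=> c0 [sx px]; split=> [|v]; first by rewrite star_Zr sx.
by rewrite repZ ripZl mulr_ge0.
Qed.
Lemma pos_conj z x : pos x -> pos (star z * x * z).
Proof.
move=> [sx px]; split=> [|v]; first by rewrite !starM starK sx mulrA.
by rewrite !repM rip_star.
Qed.
Lemma pos_sq z : pos (star z * z).
Proof. by rewrite -[star z]mulr1; apply/pos_conj/pos1. Qed.
Lemma rip_sq z v : rip (rep (star z * z) v) v = hnorm (rep z v) ^+ 2.
Proof. by rewrite repM rip_star rip_hnorm. Qed.
Lemma pos_le x y v : pos (y - x) -> rip (rep x v) v <= rip (rep y v) v.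
Proof. by move=> [_ /(_ v)]; rewrite repB ripBl subr_ge0. Qed.

(** Cauchy-Schwarz for the form of a positive operator, in the shape of the bound
obtained by evaluating the form at v - (1/K) x v. *)
Lemma pos_sqnorm K x v : pos x -> 0 < K ->
  (forall w, rip (rep x w) w <= K * hnorm w ^+ 2) ->
  hnorm (rep x v) ^+ 2 <= K * rip (rep x v) v.
Proof.
move=> [sx px] K0 h; set t := K^-1; set w := rep x v.
have := px (v - t%:C *: w).
rewrite linearB linearZ /= -/w ripBl !ripBr !ripZl !ripZr.
rewrite -[in rip (rep x w) v]sx rip_star -/w rip_hnorm.
have tn : t * (t * rip (rep x w) w) <= t * hnorm w ^+ 2.
  by rewrite ler_pM2l ?invr_gt0// ler_pdivrMl.
move=> h1; have {h1 tn} : t * hnorm w ^+ 2 <= rip w v by lra.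
by rewrite ler_pdivrMl.
Qed.

Lemma pos_null x v : pos x -> rip (rep x v) v = 0 -> rep x v = 0.
Proof.
move=> px xv; have [K K0 /op_boundedP hK] := op_bounded_exists x.
apply: hnorm_eq0; apply/eqP; rewrite -sqrf_eq0 eq_le sqr_ge0 andbT.
rewrite -[leRHS](mulr0 K) -xv; apply: pos_sqnorm => // w.
apply: le_trans (ler_norm _) _; apply: le_trans (rip_CS _ _) _.
by rewrite expr2 mulrA ler_wpM2r ?hnorm_ge0.
Qed.

Lemma pos_anti x : pos x -> pos (- x) -> x = 0.
Proof.
move=> px [_ nx]; apply: rep_inj => v; apply: pos_null => //.
apply/eqP; rewrite eq_le; case: px => _ ->; rewrite andbT.
by have := nx v; rewrite repN ripNl oppr_ge0.
Qed.

Lemma form_ext x y : star x = x -> star y = y ->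
  (forall v, rip (rep x v) v = rip (rep y v) v) -> x = y.
Proof.
move=> sx sy h; apply/eqP; rewrite -subr_eq0; apply/eqP/pos_anti.
  by split=> [|v]; rewrite ?star_B ?sx ?sy// repB ripBl h subrr.
by split=> [|v]; rewrite opprB ?star_B ?sx ?sy// repB ripBl h subrr.
Qed.

Lemma sq_eq0 z : star z * z = 0 -> z = 0.
Proof.
move=> h; apply: rep_inj => v; apply: hnorm_eq0; apply/eqP.
by rewrite -sqrf_eq0 -rip_sq h rep0 rip0l.
Qed.

Lemma pos_compress b z : pos b -> star z * b * z = 0 -> b * z = 0.
Proof.
move=> pb h; apply: rep_inj => v; rewrite repM; apply: pos_null => //.
by rewrite -rip_star -!repM ?mulrA h rep0 rip0l.
Qed.

Lemma pos_le1_bounded x : pos x -> pos (1 - x) -> op_bounded 1 x.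
Proof.
move=> px px1; apply/op_boundedP => v.
have h : hnorm (rep x v) ^+ 2 <= rip (rep x v) v.
  rewrite -[leRHS]mul1r; apply: pos_sqnorm => // w; rewrite mul1r -rip_hnorm.
  by have := pos_le w px1; rewrite rep1.
rewrite mul1r; have [->|v0] := eqVneq (rep x v) 0.
  by rewrite hnorm0 hnorm_ge0.
have xv0 : 0 < hnorm (rep x v).
  rewrite lt_neqAle hnorm_ge0 andbT eq_sym.
  by apply: contra_neq v0; exact: hnorm_eq0.
rewrite -(ler_pM2l xv0) -expr2; apply: le_trans h _.
exact: le_trans (ler_norm _) (rip_CS _ _).
Qed.

Lemma bounded1_pos z : op_bounded 1 z -> pos (1 - star z * z).
Proof.
move=> /op_boundedP h; split=> [|v]; first by rewrite star_B star_1 starM starK.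
rewrite repB rep1 ripBl rip_sq rip_hnorm subr_ge0 ler_sqr ?nnegrE ?hnorm_ge0//.
by have := h v; rewrite mul1r.
Qed.

Lemma pos_bounded1 z : pos (1 - star z * z) -> op_bounded 1 z.
Proof.
move=> h; apply/op_boundedP => v; rewrite mul1r.
rewrite -ler_sqr ?nnegrE ?hnorm_ge0// -rip_sq -rip_hnorm.
by have := pos_le v h; rewrite rep1.
Qed.

Lemma scvg_pos T (F : set_system T) {PF : ProperFilter F} (x : T -> N) y :
  (forall t, pos (x t)) -> scvg F x y -> pos y.
Proof.
move=> px hx; split=> [|v].
  by apply: (scvg_star_eq (x := x) (y := x) _ hx hx) => t; case: (px t).
apply: (closed_cvg (fun r : R => 0 <= r) _ _ _ (scvg_rip (v := v) (w := v) hx)).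
  exact: closed_ge.
by apply: nearW => t; case: (px t).
Qed.

(** A monotone bounded real sequence that dominates the squared increments of f
forces f to be Cauchy. *)
Lemma mono_cauchy (f : nat -> vnspace N) (r : nat -> R) (C : R) :
  (forall l m, (l <= m)%N -> hnorm (f m - f l) ^+ 2 <= r m - r l) ->
  (forall k, r k <= C) ->
  forall e : R, 0 < e -> exists l, \forall k \near \oo, hnorm (l - f k) < e.
Proof.
move=> hf rC e e0.
have rsup : has_sup [set r k | k in setT].
  by split; [exists (r 0%N), 0%N|exists C => _ [k _ <-]].
have e2 : 0 < e ^+ 2 by rewrite exprn_gt0.
have [_ [n _ <-] hn] := sup_adherent e2 rsup.
exists (f n); near=> k; have nk : (n <= k)%N by near: k; exact: nbhs_infty_ge.
rewrite hnorm_sub -ltr_sqr ?nnegrE ?hnorm_ge0 ?(ltW e0)//.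
apply: le_lt_trans (hf _ _ nk) _; rewrite ltrBlDl -ltrBlDr.
by apply: le_lt_trans hn; rewrite lerB// ub_le_sup//; case: rsup => //; exists k.
Unshelve. all: by end_near. Qed.

Lemma scvg_shift (x : nat -> N) y : scvg \oo x y -> scvg \oo (fun k => x k.+1) y.
Proof.
move=> hx v e e0; have [n _ h] := hx v e e0; exists n => // k /= nk.
by apply: h; exact: leqW.
Qed.

(** The increments are positive contractions, so the squared norm of their value at
v is at most their form at v, which telescopes. *)
Lemma mono_strong (x : nat -> N) : (forall k, pos (x k)) ->
  (forall k, pos (1 - x k)) -> (forall l m, (l <= m)%N -> pos (x m - x l)) ->
  exists y, scvg \oo x y.
Proof.
move=> px px1 mx; apply: (@strong_limit _ _ _ _ _ 1).
  by apply: nearW => k; exact: pos_le1_bounded.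
move=> v; apply: (mono_cauchy (r := fun k => rip (rep (x k) v) v)
    (C := rip (rep 1 v) v)) => [l m lm|k]; last exact: pos_le.
rewrite -repB -ripBl -repB -[leRHS]mul1r; apply: pos_sqnorm => // [|w]; first exact: mx.
rewrite mul1r -rip_hnorm; have h : pos (1 - (x m - x l)).
  by rewrite opprB addrCA; exact: posD.
by have := pos_le w h; rewrite rep1.
Qed.

Lemma half_step_eq0 x z : x = x + ((2^-1)%:C)%:A * z -> z = 0.
Proof.
move=> /(congr1 (fun t => t - x)); rewrite subrr [x + _]addrC addrK => /esym.
rewrite -scalerAl mul1r => /(congr1 ( *:%R (2%:C))); rewrite scaler0 scalerA.
by rewrite -(rmorphM (real_complex R)) mulfV ?pnatr_eq0// scale1r.
Qed.

Section PolynomialCalculus.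
Context (b : N).
Hypotheses (pb : pos b) (pb1 : pos (1 - b)).
Notation ev := (horner_alg b).

Lemma evZ (a : R[i]) p : ev (a *: p) = a *: ev p.
Proof. by rewrite -mul_polyC rmorphM /= horner_algC -scalerAl mul1r. Qed.

(** By induction on the certificate: multiplying p by X twice amounts to compressing
p by b, and likewise for 1 - X. The statement is strengthened to the four products
of p by 1, X, 1 - X and X (1 - X), so that the induction closes up. *)
Lemma cone_pos p : cone p -> pos (ev p).
Proof.
move=> hp; suff : [/\ pos (ev p), pos (ev ('X * p)), pos (ev ((1 - 'X) * p))
  & pos (ev ('X * (1 - 'X) * p))] by case.
have [sb _] := pb; have [sb1 _] := pb1.
have cX q : pos (ev q) -> pos (ev ('X * q * 'X)).
  by move=> /(pos_conj b); rewrite sb !rmorphM /= horner_algX.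
have c1X q : pos (ev q) -> pos (ev ((1 - 'X) * q * (1 - 'X))).
  move=> /(pos_conj (1 - b)); rewrite sb1.
  by rewrite !rmorphM rmorphB rmorph1 /= horner_algX.
elim: hp => [||q r _ [a1 a2 a3 a4] _ [b1 b2 b3 b4]|c q c0 _ [a1 a2 a3 a4]
    |q _ [a1 a2 a3 a4]|q _ [a1 a2 a3 a4]].
- by rewrite !mulr0 rmorph0; split; exact: pos0.
- rewrite !mulr1 rmorph1; split; first exact: pos1.
  + by rewrite /= horner_algX.
  + by rewrite rmorphB rmorph1 /= horner_algX.
  + rewrite (_ : 'X * (1 - 'X) = 'X * (1 - 'X) * 'X + (1 - 'X) * 'X * (1 - 'X)).
      rewrite rmorphD; apply: posD; [apply: cX|apply: c1X].
        by rewrite rmorphB rmorph1 /= horner_algX.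
      by rewrite /= horner_algX.
    by ring.
- by rewrite !(mulrDr _ q r) !(rmorphD (horner_alg b)); split; exact: posD.
- by rewrite -!scalerAr; split; rewrite evZ; exact: posZ.
- split => //.
  + by rewrite (_ : 'X * ('X * q) = 'X * q * 'X); [exact: cX|ring].
  + by rewrite (_ : (1 - 'X) * ('X * q) = 'X * (1 - 'X) * q); [|ring].
  + rewrite (_ : 'X * (1 - 'X) * ('X * q) = 'X * ((1 - 'X) * q) * 'X); last by ring.
    exact: cX.
- split => //.
  + by rewrite (_ : 'X * ((1 - 'X) * q) = 'X * (1 - 'X) * q); [|ring].
  + rewrite (_ : (1 - 'X) * ((1 - 'X) * q) = (1 - 'X) * q * (1 - 'X)); last by ring.
    exact: c1X.
  + rewrite (_ : 'X * (1 - 'X) * ((1 - 'X) * q) = (1 - 'X) * ('X * q) * (1 - 'X)).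
      exact: c1X.
    by ring.
Qed.

Lemma ev_comm z p : z * b = b * z -> z * ev p = ev p * z.
Proof.
move=> zb; elim/poly_ind: p => [|p c IH]; first by rewrite rmorph0 mulr0 mul0r.
rewrite rmorphD rmorphM /= horner_algX horner_algC mulrDr mulrDl.
by rewrite mulrA IH -!mulrA zb -scalerAr -scalerAl mulr1 mul1r.
Qed.

(** The limits s and p are the square root and the support projection of b. Passing
to the limit in the recurrence gives s (1 - p) = 0, hence b (1 - p) = 0 since
b <= s; and s^2 is the limit of b (X Q^2)(b), that is, b p. *)
Lemma newton_limits : exists s p, [/\ scvg \oo (fun k => ev (newton_sqrt k)) s,
  scvg \oo (fun k => ev (newton_sq k)) p, pos s, pos p & s * s = b /\ b * p = b].
Proof.
have evB p q : ev p - ev q = ev (p - q) by rewrite rmorphB.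
have ev1 : 1 = ev 1 by rewrite rmorph1.
have S0 k := cone_pos (cone_newton_sqrt k).1.
have S1 k : pos (1 - ev (newton_sqrt k)).
  by rewrite ev1 evB; apply: cone_pos; have [_] := @cone_newton_sqrt R k.
have B0 k : pos (ev (newton_sq k)) by have [_ h _] := @cone_newton R k; exact: cone_pos.
have B1 k : pos (1 - ev (newton_sq k)).
  by rewrite ev1 evB; have [_ _ h] := @cone_newton R k; exact: cone_pos.
have Sm l m : (l <= m)%N -> pos (ev (newton_sqrt m) - ev (newton_sqrt l)).
  by rewrite evB => lm; apply: cone_pos; exact: cone_newton_sqrt_mono.
have Bm l m : (l <= m)%N -> pos (ev (newton_sq m) - ev (newton_sq l)).
  by rewrite evB => lm; apply: cone_pos; exact: cone_newton_sq_mono.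
have [s hs] := mono_strong S0 S1 Sm; have [p hp] := mono_strong B0 B1 Bm.
have ps : pos s by exact: scvg_pos S0 hs.
have pp : pos p by exact: scvg_pos B0 hp.
exists s, p.
have Sb k : op_bounded 1 (ev (newton_sqrt k)) by exact: pos_le1_bounded.
have ss : s * s = b * p.
  apply: (scvg_unique (scvgM Sb hs hs)).
  apply: eq_scvg (scvg_mull b hp) => k.
  by rewrite -rmorphM newton_sqrt_sq [RHS]rmorphM /= horner_algX.
have sp : s * (1 - p) = 0.
  have h1 : scvg \oo (fun k => ev (newton_sqrt k.+1)) s.
    exact: (scvg_shift hs).
  have h2 : scvg \oo (fun k => ev (newton_sqrt k.+1))
      (s + ((2^-1)%:C)%:A * (s * (1 - p))).
    have h3 : scvg \oo (fun k => ev (newton_sqrt k) * (1 - ev (newton_sq k)))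
        (s * (1 - p)).
      by apply: scvgM Sb hs _; apply: scvgB hp; exact: scvg_cst.
    apply: eq_scvg (scvgD hs (scvg_mull ((2^-1)%:C)%:A h3)) => k.
    rewrite newton_sqrtS rmorphD /= evZ (rmorphM _ (newton_sqrt k)) rmorphB rmorph1 /=.
    by rewrite -scalerAl mul1r.
  by apply: (half_step_eq0 (x := s)); exact: (scvg_unique h1 h2).
have bs : pos (s - b).
  apply: scvg_pos (scvgB hs (scvg_cst b)) => k.
  have := Sm _ _ (leq0n k).
  by rewrite {2}/newton_sqrt /= mulr1 horner_algX.
have sp1 : star (1 - p) = 1 - p by case: pp => sp' _; rewrite star_B star_1 sp'.
have bp : b * (1 - p) = 0.
  apply: pos_compress => //; apply: pos_anti; first exact: pos_conj.
  have := pos_conj (1 - p) bs.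
  by rewrite -!mulrA [(s - b) * _]mulrBl sp sub0r mulrN.
have bpE : b * p = b.
  by move: bp; rewrite mulrBr mulr1 => /eqP; rewrite subr_eq0 => /eqP.
by split => //; rewrite ss.
Qed.

Lemma pos_sqrt1 : exists2 s, pos s & s * s = b.
Proof. by have [s [p [_ _ ps _ [ss _]]]] := newton_limits; exists s. Qed.
End PolynomialCalculus.
End Positive.

(** * Polar decomposition *)

Section Polar.
Context {R : realType} {N : vonNeumannType R}.
Implicit Types (x y z v b : N) (K : R).

(** v is the phase of y in its polar decomposition y = v |y|, where |y| = v^* y. The
annihilator conditions say, in terms of the algebra, that v has no larger range and no
smaller kernel than y. *)
Definition polar_of y v :=
  [/\ v * star v * v = v, v * star v * y = y, pos (star v * y),
      (star v * y) * (star v * y) = star y * y &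
   [/\ forall z, z * y = 0 -> z * v = 0, forall z, y * z = 0 -> v * z = 0 &
       star y = y -> star v = v]].

(** With b = y^* y, the operators y Q_k(b) converge strongly to a phase v: the
limits s and p of the iteration at b are v^* y and v^* v, and the recurrence passes
to the limit as v (1 - v^* v) = 0. *)
Lemma polar_contraction y : op_bounded 1 y -> exists v, polar_of y v.
Proof.
move=> hy; set b := star y * y.
have pb : pos b by exact: pos_sq.
have pb1 : pos (1 - b) by exact: bounded1_pos.
have [s [p [hs hp ps pp [ssE bpE]]]] := newton_limits pb pb1.
pose f k := y * horner_alg b (newton k).
have evs k : star (horner_alg b (newton k)) = horner_alg b (newton k).
  by have [h _ _] := @cone_newton R k; have [] := cone_pos pb pb1 h.
have evb q : b * horner_alg b q = horner_alg b ('X * q) by rewrite rmorphM /= horner_algX.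
have evc q : horner_alg b q * b = b * horner_alg b q by rewrite (ev_comm (z := b)).
have fsq (q : {poly R[i]}) : star (horner_alg b q) = horner_alg b q ->
    star (y * horner_alg b q) * (y * horner_alg b q) = horner_alg b ('X * q ^+ 2).
  move=> sq; rewrite starM sq -!mulrA (mulrA (star y)) -/b mulrA evc -mulrA.
  by rewrite -rmorphM evb expr2.
have f_sq k : star (f k) * f k = horner_alg b (newton_sq k) by exact: fsq.
have f1 k : op_bounded 1 (f k).
  apply: pos_bounded1; rewrite f_sq -[X in X - _](rmorph1 (horner_alg b)) -rmorphB.
  by apply: cone_pos => //; have [] := @cone_newton R k.
have [v hv] : exists v, scvg \oo f v.
  apply: (@strong_limit _ _ _ _ _ 1); first exact: nearW.
  move=> w; apply: (mono_cauchy (r := fun k => rip (rep (horner_alg b (newton_sq k)) w) w)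
    (C := rip (rep 1 w) w)) => [l m lm|k].
    rewrite -repB -ripBl -repB -rip_sq /f -mulrBr -rmorphB fsq; last first.
      by rewrite rmorphB star_B !evs.
    apply: pos_le; rewrite -!rmorphB; apply: cone_pos => //.
    exact: cone_newton_diff.
  rewrite -f_sq; apply: pos_le; exact: bounded1_pos.
have pE : p = star v * v.
  apply: form_ext; [by case: pp|by case: (pos_sq v)|move=> w].
  rewrite rip_sq; apply: (cvg_unique _ (scvg_rip (v := w) (w := w) hp)).
    exact: Rhausdorff.
  rewrite (_ : (fun k => _) = fun k => hnorm (rep (f k) w) ^+ 2); last first.
    by apply/funext => k; rewrite -f_sq rip_sq.
  exact: hcvg_sqnorm (hv w).
have vv : v * star v * v = v.
  have h1 : scvg \oo (fun k => f k.+1) v by exact: (scvg_shift hv).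
  have h2 : scvg \oo (fun k => f k.+1) (v + ((2^-1)%:C)%:A * (v * (1 - p))).
    have h3 : scvg \oo (fun k => f k * (1 - horner_alg b (newton_sq k))) (v * (1 - p)).
      by apply: scvgM f1 hv _; apply: scvgB hp; exact: scvg_cst.
    apply: eq_scvg (scvgD hv (scvg_mull ((2^-1)%:C)%:A h3)) => k.
    rewrite /f [newton k.+1]/= rmorphD /= evZ [y * (_ + _)]mulrDr -scalerAl mul1r.
    rewrite [horner_alg b (_ * (1 - _))]rmorphM rmorphB rmorph1 -/(newton_sq k).
    by rewrite -scalerAr mulrA.
  have : v * (1 - p) = 0.
    by apply: (half_step_eq0 (x := v)); exact: (scvg_unique h1 h2).
  by rewrite pE mulrBr mulr1 mulrA => /eqP; rewrite subr_eq0 => /eqP.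
have sE : star v * y = s.
  apply: rep_ext => a w; rewrite repM rip_star.
  apply: (cvg_unique _ _ (scvg_rip (v := a) (w := w) hs)); first exact: Rhausdorff.
  rewrite ripC (_ : (fun k => _) = fun k => rip (rep (f k) w) (rep y a)).
    by apply: rip_cvg; exact: hv.
  apply/funext => k.
  have [sq _] := cone_pos pb pb1 (cone_newton_sqrt k).1.
  rewrite -[in LHS]sq rip_star ripC /newton_sqrt -evb /b /f !repM.
  by rewrite rip_star.
have yp : y * (1 - p) = 0.
  apply: sq_eq0; rewrite starM mulrA -[star (1 - p) * _ * _]mulrA -/b -mulrA mulrBr.
  by rewrite mulr1 bpE subrr mulr0.
have vs : v * s = y.
  apply: (@scvg_unique _ _ _ \oo _ (fun k => f k * horner_alg b (newton_sqrt k))).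
    exact: scvgM f1 hv hs.
  move: yp; rewrite mulrBr mulr1 => /eqP; rewrite subr_eq0 => /eqP ->.
  apply: eq_scvg (scvg_mull y hp) => k.
  by rewrite /f -mulrA -rmorphM; congr (y * horner_alg b _); rewrite /newton_sq /newton_sqrt; ring.
exists v; split => //; rewrite ?sE//.
  by rewrite -mulrA sE.
split=> [z zy|z yz|sy].
- apply: (scvg_unique (scvg_mull z hv)).
  by apply: eq_scvg (scvg_cst 0) => k; rewrite /f mulrA zy mul0r.
- rewrite -vv -(mulrA v) -pE -mulrA (_ : p * z = 0) ?mulr0//.
  apply: (scvg_unique (scvg_mulr z hp)).
  apply: eq_scvg (scvg_cst 0) => k.
  by rewrite rmorphM /= horner_algX -evc -mulrA /b -mulrA yz !mulr0.
- apply: (scvg_star_eq (x := f) (y := f) _ hv hv) => k.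
  by rewrite /f starM evs sy -(ev_comm (z := y))// /b sy mulrA.
Qed.

Lemma polar y : exists v, polar_of y v.
Proof.
have [K K0 hK] := op_bounded_exists y; set a := (K^-1)%:C.
have y1 : op_bounded 1 (a *: y).
  apply/op_boundedP => w; rewrite repZ hnormZ ger0_norm ?invr_ge0 ?(ltW K0)//.
  by rewrite mul1r mulrC ler_pdivrMr// mulrC; exact: (op_boundedP _ _).1.
have yE : y = K%:C *: (a *: y).
  by rewrite scalerA -(rmorphM (real_complex R)) mulfV ?gt_eqF// scale1r.
move: y1 yE; set y' := a *: y => y1; clearbody y' => ->.
have [v [h1 h2 h3 h4 [h5 h6 h7]]] := polar_contraction y1.
have k0 : 0 <= K by exact: ltW.
have KK (z : N) : K^-1%:C *: (K%:C *: z) = z.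
  by rewrite scalerA -(rmorphM (real_complex R)) mulVf ?gt_eqF// scale1r.
exists v; split => //.
- by rewrite -scalerAr h2.
- by rewrite -scalerAr; exact: posZ.
- by rewrite star_Zr -!scalerAr -!scalerAl h4.
- split=> [z zy|z yz|sy]; [apply: h5|apply: h6|apply: h7].
  + by rewrite -[y']KK -scalerAr zy scaler0.
  + by rewrite -[y']KK -scalerAl yz scaler0.
  + by rewrite -[y']KK star_Zr sy.
Qed.
End Polar.

(** * Exhaustion by partial isometries *)

Section PartialIsometries.
Context {R : realType} {M : tracialVNType R}.
Implicit Types (x y z v w V : M) (e f p q r : M).

Definition pisom v := v * star v * v = v.
Definition proj e := star e = e /\ e * e = e.

Lemma proj0 : proj 0.
Proof. by rewrite /proj star_0 mul0r. Qed.
Lemma projC e : proj e -> proj (1 - e).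
Proof.
move=> [se ee]; split; first by rewrite star_B star_1 se.
by rewrite mulrBr mulr1 mulrBl mul1r ee subrr subr0.
Qed.
Lemma proj_pos e : proj e -> pos e.
Proof. by move=> [se ee]; rewrite -ee -{1}se; exact: pos_sq. Qed.
Lemma pisom_dom v : pisom v -> proj (star v * v).
Proof. by move=> hv; split; rewrite ?starM ?starK// -!mulrA (mulrA v) hv. Qed.
Lemma pisom_star v : pisom v -> pisom (star v).
Proof. by move=> /(congr1 star); rewrite !starM !starK mulrA /pisom starK. Qed.
Lemma pisom_ran v : pisom v -> proj (v * star v).
Proof. by move=> /pisom_star /pisom_dom; rewrite starK. Qed.
Lemma proj_pisom e : proj e -> pisom e.
Proof. by move=> [se ee]; rewrite /pisom se !ee. Qed.
Lemma pisom0 : pisom 0. Proof. exact/proj_pisom/proj0. Qed.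

Lemma pisom_bounded v : pisom v -> op_bounded 1 v.
Proof. by move=> /pisom_dom /projC /proj_pos; exact: pos_bounded1. Qed.

Lemma pisom_sqnorm2 v : pisom v -> sqnorm2 v <= 1.
Proof. by move=> /pisom_bounded /sqnorm2_le; rewrite expr1n. Qed.

Lemma star_mul0 x y : star x * y = 0 -> star y * x = 0.
Proof. by move=> h; rewrite -[x]starK -starM h star_0. Qed.
Lemma mul_star0 x y : x * star y = 0 -> y * star x = 0.
Proof. by move=> h; rewrite -[y]starK -starM h star_0. Qed.

Lemma pisomD V v : pisom V -> pisom v -> star V * v = 0 -> v * star V = 0 ->
  pisom (V + v).
Proof.
move=> hV hv h1 h2; have h3 := star_mul0 h1; have h4 := mul_star0 h2.
have E : (V + v) * (star V + star v) = V * star V + v * star v.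
  by rewrite mulrDr !mulrDl h2 h4 addr0 add0r.
rewrite /pisom starD E mulrDr !mulrDl hV hv -!mulrA h1 h3 !mulr0.
by rewrite addr0 add0r.
Qed.

Lemma sqnorm2_orthD x y : star x * y = 0 ->
  sqnorm2 (x + y) = sqnorm2 x + sqnorm2 y.
Proof.
move=> h; rewrite /sqnorm2 starD mulrDl !mulrDr h (star_mul0 h) addr0 add0r.
by rewrite traceD raddfD.
Qed.

(** The extension order of partial isometries: V agrees with v on the initial space
of v, and V^* agrees with v^* on its final space. *)
Definition pext v V := star v * V = star v * v /\ V * star v = v * star v.

Lemma pext_orthl v V w : pisom v -> pext v V -> star V * w = 0 -> star v * w = 0.
Proof.
move=> hv [_ h] hw; rewrite -hv -h.
by rewrite !starM starK -!mulrA hw !mulr0.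
Qed.
Lemma pext_orthr v V w : pisom v -> pext v V -> w * star V = 0 -> w * star v = 0.
Proof.
move=> hv [h _] hw; rewrite -hv -mulrA -h.
by rewrite !starM starK !mulrA hw !mul0r.
Qed.

Section Exhaustion.
(* The admissible pieces. *)
Variable Q : M -> Prop.
Hypothesis Q0 : Q 0.

Definition orth_to V v := star V * v = 0 /\ v * star V = 0.
Let cand V v := [/\ Q v, pisom v & orth_to V v].

Let half_best V : exists v, cand V v /\ forall w, cand V w -> sqnorm2 w <= 2 * sqnorm2 v.
Proof.
have c0 : cand V 0 by split; [|exact: pisom0|rewrite /orth_to mulr0 mul0r].
pose S := [set sqnorm2 w | w in cand V].
have supS : has_sup S.
  by split; [exists (sqnorm2 (0 : M)), 0|exists 1 => _ [w [_ /pisom_sqnorm2 h _] <-]].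
have [S0|S0] := leP (sup S) 0.
  exists 0; split => // w cw; apply: le_trans (mulr_ge0 _ (sqnorm2_ge0 _)) => //.
  by apply: le_trans S0; apply: ub_le_sup; [case: supS|exists w].
have S2 : 0 < sup S / 2 by rewrite divr_gt0.
have [_ [v cv <-] hv] := sup_adherent S2 supS.
exists v; split => // w cw; apply: (@le_trans _ _ (sup S)).
  by apply: ub_le_sup; [case: supS|exists w].
by move: hv; lra.
Qed.

(** Adding at each step a piece that is orthogonal to the previous ones and whose
trace is at least half of the best possible one produces in the limit a partial
isometry V that no piece enlarges: the traces of the chosen pieces are summable,
whereas the trace of an orthogonal piece would be at most twice each of them. V
has every additive and strongly closed property L that the pieces have. *)
Lemma exhaustion : exists V, [/\ pisom V,
  forall L : M -> Prop, L 0 -> (forall x y, L x -> L y -> L (x + y)) ->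
    (forall (x : nat -> M) y, (forall n, L (x n)) -> scvg \oo x y -> L y) ->
    (forall v, Q v -> L v) -> L V &
  forall v, Q v -> pisom v -> orth_to V v -> v = 0].
Proof.
have /choice[st hst] := half_best.
pose W := fix W n := if n is n'.+1 then W n' + st (W n') else 0.
have Wp n : pisom (W n).
  elim: n => [|n IH] /=; first exact: pisom0.
  by have [[_ h [h1 h2]] _] := hst (W n); exact: pisomD.
have We l m : (l <= m)%N -> pext (W l) (W m).
  elim: m => [|m IH]; first by rewrite leqn0 => /eqP ->.
  rewrite leq_eqVlt => /orP[/eqP -> //|]; rewrite ltnS => /IH k.
  have [[_ _ [h1 h2]] _] := hst (W m).
  have k1 := pext_orthl (Wp l) k h1; have k2 := pext_orthr (Wp l) k h2.
  by case: k => e1 e2; split; rewrite /= ?mulrDr ?mulrDl ?k1 ?k2 addr0.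
have Wd l m a : (l <= m)%N ->
    hnorm (rep (W m) a - rep (W l) a) ^+ 2 <=
    hnorm (rep (W m) a) ^+ 2 - hnorm (rep (W l) a) ^+ 2.
  move=> /We[e1 _]; rewrite -!rip_hnorm ripBl !ripBr.
  rewrite (ripC (rep (W l) a) (rep (W m) a)).
  have -> : rip (rep (W m) a) (rep (W l) a) = rip (rep (W l) a) (rep (W l) a).
    by rewrite -[LHS]rip_star -repM e1 repM rip_star.
  by lra.
have [V hV] : exists V, scvg \oo W V.
  apply: (@strong_limit _ _ _ _ _ 1).
    by apply: nearW => n; exact/pisom_bounded/Wp.
  move=> a; apply: (mono_cauchy (r := fun n => hnorm (rep (W n) a) ^+ 2)
      (C := hnorm a ^+ 2)) => [l m lm|n]; first exact: Wd.
  rewrite ler_sqr ?nnegrE ?hnorm_ge0// -[leRHS]mul1r.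
  by have /op_boundedP := pisom_bounded (Wp n); apply.
have WV n : pext (W n) V.
  have nn : \forall m \near \oo, (n <= m)%N by exact: nbhs_infty_ge.
  split.
    apply: (scvg_unique (scvg_mull (star (W n)) hV)) => a.
    apply: hcvg_near_eq (hcvg_cst _) _; apply: filterS nn => m /We[-> _] //.
  apply: (scvg_unique (scvg_mulr (star (W n)) hV)) => a.
  by apply: hcvg_near_eq (hcvg_cst _) _; apply: filterS nn => m /We[_ ->].
exists V; split.
- apply: rep_ext => a w; apply: (cvg_unique _ _ (scvg_rip (v := a) (w := w) hV)).
    exact: Rhausdorff.
  have -> : rip (rep (V * star V * V) a) w = rip (rep V (rep (star V) w)) (rep V a).
    by rewrite -mulrA repM ripC -rip_star repM -rip_star starK.
  rewrite (_ : (fun n => _) = fun n => rip (rep (W n) (rep (star V) w)) (rep V a)).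
    exact: scvg_rip hV.
  apply/funext => n; rewrite [RHS]ripC -[RHS]rip_star -[RHS]rip_star starK -!repM.
  by have [e1 e2] := WV n; rewrite ?mulrA e2 -mulrA e1 mulrA Wp.
- move=> L L0 LD Ls LQ; apply: Ls hV; elim=> [//|n IH] /=.
  by apply: LD => //; apply: LQ; have [[]] := hst (W n).
- move=> v Qv pv [v1 v2]; apply: sqnorm2_eq0; apply/eqP.
  rewrite eq_le sqnorm2_ge0 andbT.
  have cv n : cand (W n) v.
    split => //; split; first exact: pext_orthl (Wp n) (WV n) v1.
    exact: pext_orthr (Wp n) (WV n) v2.
  have vn n : sqnorm2 v *+ n <= 2 * sqnorm2 (W n).
    elim: n => [|n IH]; first by rewrite mulr0n mulr_ge0 ?sqnorm2_ge0.
    have [[_ _ [h1 _]] h] := hst (W n).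
    by rewrite mulrSr /= sqnorm2_orthD// mulrDr lerD// h.
  rewrite leNgt; apply/negP => v0.
  have := archi_boundP (divr_ge0 (ler0n R 2) (ltW v0)); set n := Num.bound _.
  rewrite ltr_pdivrMr// mulr_natl ltNge => /negP; apply.
  apply: le_trans (vn n) _; rewrite -[leRHS]mulr1 ler_wpM2l//.
  exact/pisom_sqnorm2/Wp.
Qed.
End Exhaustion.
End PartialIsometries.

(** * Comparison of projections in a factor *)

Section Comparison.
Context {R : realType} {M : tracialVNType R}.
Implicit Types (x y z v w V : M) (e f p q r s : M).
Hypothesis M_factor : Defs.factor M.

(** The operators y with q M y = 0 form a strongly closed two-sided ideal J. The
projection E obtained by exhausting the projections of J is a unit for J: the
phases of x (1 - E) and (1 - E) x, for x in J, would otherwise yield projections of J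
orthogonal to E. So E commutes with M, and is a scalar. *)
Lemma factor_prime q y : (forall z, q * z * y = 0) -> q = 0 \/ y = 0.
Proof.
move=> qy; pose J x := forall z, q * z * x = 0.
have Jl a x : J x -> J (a * x) by move=> h z; rewrite mulrA -(mulrA q) h.
have Jr a x : J x -> J (x * a) by move=> h z; rewrite mulrA h mul0r.
have [|e [pe cl mx]] := @exhaustion _ M (fun x => proj x /\ J x).
  by split=> [|z]; [exact: proj0|rewrite mulr0].
have se : star e = e.
  apply: (cl (fun x => star x = x)) => [|x x'|x x' h hx|x [[]]//]; first exact: star_0.
    by rewrite starD => -> ->.
  exact: (scvg_star_eq h hx hx).
have Je : J e.
  apply: (cl J) => [z|x x' h h' z|x x' h hx z|x []//]; first by rewrite mulr0.
    by rewrite mulrDr h h' addr0.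
  apply: (scvg_unique (scvg_mull (q * z) hx)).
  by apply: eq_scvg (scvg_cst 0) => n; rewrite h.
set E := e * e; have Ee : E * e = e by move: pe; rewrite /pisom se.
have eE : e * E = e by rewrite /E mulrA.
have JE : J E by exact: Jl.
have JEr x : J x -> x * E = x.
  move=> Jx; have [v [v1 v2 _ _ [v3 v4 _]]] := polar (x * (1 - E)).
  have x0 : x * (1 - E) * E = 0.
    by rewrite -mulrA mulrBl mul1r {2}/E mulrA Ee subrr mulr0.
  have Jv : J v by move=> z; apply: v3; rewrite mulrA Jx mul0r.
  have vE : v * E = 0 by exact: v4.
  have ve : v * e = 0 by rewrite -Ee mulrA vE mul0r.
  have /mx : proj (star v * v) /\ J (star v * v).
    by split; [exact: pisom_dom|exact: Jl].
  have f0 : star v * v * e = 0 by rewrite -mulrA ve mulr0.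
  have f0' : star e * (star v * v) = 0.
    by rewrite -[RHS](@star_0 _ M) -f0 !starM starK.
  move=> h; have vv : star v * v = 0.
    apply: h; first exact/proj_pisom/pisom_dom.
    by split; rewrite // se.
  have v0 : v = 0 by rewrite -v1 -mulrA vv mulr0.
  have : x * (1 - E) = 0 by rewrite -v2 v0 !mul0r.
  by rewrite mulrBr mulr1 => /eqP; rewrite subr_eq0 => /eqP.
have JEl x : J x -> E * x = x.
  move=> Jx; have [v [v1 v2 _ _ [v3 v4 _]]] := polar ((1 - E) * x).
  have x0 : E * ((1 - E) * x) = 0.
    by rewrite mulrA mulrBr mulr1 {2}/E mulrA Ee subrr mul0r.
  have Jv : J v by move=> z; apply: v3; rewrite mulrA -(mulrA q) Jx.
  have vE : E * v = 0 by exact: v3.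
  have ve : e * v = 0 by rewrite -eE -mulrA vE mulr0.
  have f0' : star e * (v * star v) = 0 by rewrite se mulrA ve mul0r.
  have f0 : v * star v * star e = 0.
    by rewrite -[RHS](@star_0 _ M) -f0' !starM !starK se.
  have vv : v * star v = 0.
    apply: mx => //; first by split; [exact: pisom_ran|exact: Jr].
    exact/proj_pisom/pisom_ran.
  have v0 : v = 0 by rewrite -v1 vv mul0r.
  have : (1 - E) * x = 0 by rewrite -v2 v0 !mul0r.
  by rewrite mulrBl mul1r => /eqP; rewrite subr_eq0 => /eqP.
have [c cE] : exists c, E = c%:A.
  apply: M_factor => a.
  by rewrite -[LHS]JEr; [rewrite -[RHS]JEl ?mulrA//; exact: Jl|exact: Jr].
have [c0|c0] := eqVneq c 0.
  right; rewrite -(JEr y)//.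
  by rewrite cE c0 scale0r mulr0.
left; have := JE 1; rewrite mulr1 cE -scalerAr mulr1 => /(congr1 ( *:%R c^-1)).
by rewrite scalerA mulVf// scale1r scaler0.
Qed.

(** Let V be a maximal partial isometry from a part of r to a part of q, and let r'
and q' be the parts left over. The phase of an element of q' M r' would enlarge V, so
that q' M r' = 0, and one of r' and q' vanishes because factors are prime. *)
Lemma comparison r q : proj r -> proj q -> exists V,
  [/\ pisom V, V * r = V, q * V = V & star V * V = r \/ V * star V = q].
Proof.
move=> pr pq; have [sr rr] := pr; have [sq qq] := pq.
have [|V [pV cl mx]] := @exhaustion _ M (fun v => q * v = v /\ v * r = v).
  by rewrite mulr0 mul0r.
have [qV Vr] : q * V = V /\ V * r = V.
  apply: (cl (fun v => q * v = v /\ v * r = v)) => //.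
  - by rewrite mulr0 mul0r.
  - by move=> x x' [h1 h2] [h3 h4]; rewrite mulrDr mulrDl h1 h2 h3 h4.
  - move=> x x' h hx; split.
      by apply: (scvg_unique (scvg_mull q hx)); apply: eq_scvg hx => n; have [->] := h n.
    by apply: (scvg_unique (scvg_mulr r hx)); apply: eq_scvg hx => n; have [_ ->] := h n.
exists V; split => //.
have rV : r * star V = star V by rewrite -{1}sr -starM Vr.
have Vq : star V * q = star V by rewrite -{1}sq -starM qV.
have pVs : star V * V * star V = star V.
  by have := pisom_star pV; rewrite /pisom starK.
set q' := q - V * star V; set r' := r - star V * V.
have qq' : q' * q' = q'.
  rewrite /q' mulrBr !mulrBl qq mulrA qV -(mulrA V _ q) Vq.
  by rewrite (mulrA (V * star V)) pV subrr subr0.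
have r'r : r' * r = r' by rewrite /r' mulrBl rr -mulrA Vr.
have q'q : q * q' = q' by rewrite /q' mulrBr qq mulrA qV.
have Vq' : star V * q' = 0 by rewrite /q' mulrBr Vq mulrA pVs subrr.
have r'V : r' * star V = 0.
  by rewrite /r' mulrBl rV pVs subrr.
have [] := @factor_prime q' r'.
- move=> z; have [v [v1 v2 _ _ [v3 v4 _]]] := polar (q' * z * r').
  have q'v : q' * v = v.
    apply/eqP; rewrite -subr_eq0 -{2}[v]mul1r -mulrBl; apply/eqP/v3.
    by rewrite !mulrA mulrBl qq' mul1r subrr !mul0r.
  have vr' : v * r = v.
    apply/eqP; rewrite -subr_eq0 -{2}[v]mulr1 -mulrBr; apply/eqP/v4.
    by rewrite -(mulrA _ r') mulrBr r'r mulr1 subrr mulr0.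
  have vV : v * star V = 0.
    by apply: v4; rewrite -(mulrA _ r') r'V mulr0.
  have Vv : star V * v = 0 by rewrite -q'v mulrA Vq' mul0r.
  have v0 : v = 0 by apply: mx => //; split => //; rewrite -q'v mulrA q'q.
  by rewrite -v2 v0 !mul0r.
- by move/eqP; rewrite subr_eq0 => /eqP ->; right.
- by move/eqP; rewrite subr_eq0 => /eqP ->; left.
Qed.

Definition tr x : R := complex.Re (trace x).

Lemma trD x y : tr (x + y) = tr x + tr y.
Proof. by rewrite /tr traceD raddfD. Qed.
Lemma trB x y : tr (x - y) = tr x - tr y.
Proof. by rewrite /tr traceB raddfB. Qed.
Lemma tr_proj e : proj e -> tr e = sqnorm2 e.
Proof. by move=> [se ee]; rewrite /sqnorm2 se ee. Qed.
Lemma tr_projI v : tr (v * star v) = tr (star v * v).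
Proof. by rewrite /tr traceC. Qed.

Lemma proj_embed r q : proj r -> proj q -> tr r <= tr q ->
  exists v, [/\ star v * v = r, q * v = v & pisom v].
Proof.
move=> pr pq rq; have [sr rr] := pr; have [V [pV Vr qV [h|h]]] := comparison pr pq.
  by exists V.
exists V; split => //; apply/esym/eqP; rewrite -subr_eq0; apply/eqP/sqnorm2_eq0.
have rV : r * star V = star V by rewrite -{1}sr -starM Vr.
have pd : proj (r - star V * V).
  split; first by rewrite star_B sr starM starK.
  rewrite mulrBr !mulrBl rr mulrA rV -(mulrA _ V r) Vr (mulrA (star V * V)).
  by rewrite -(mulrA (star V) V) -(mulrA (star V)) pV subrr subr0.
apply/eqP; rewrite eq_le sqnorm2_ge0 andbT -tr_proj// trB -tr_projI h.
by rewrite subr_le0.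
Qed.
End Comparison.

(** * Uniqueness of the trace of a factor *)

Section UniqueTrace.
Context {R : realType} {M : tracialVNType R}.
Implicit Types (x y z v w : M) (e f p q r s : M).
Hypothesis M_factor : Defs.factor M.

(* The real part of a tracial state. *)
Variable T : M -> R.
Hypothesis TD : forall x y, T (x + y) = T x + T y.
Hypothesis TZ : forall (c : R) x, T (c%:C *: x) = c * T x.
Hypothesis TC : forall x y, T (x * y) = T (y * x).
Hypothesis T_ge0 : forall x, 0 <= T (star x * x).
Hypothesis T1 : T 1 = 1.
Hypothesis T_star : forall x, T (star x) = T x.

Let TN x : T (- x) = - T x.
Proof. by rewrite -scaleN1r -(rmorphN1 (real_complex R)) TZ mulN1r. Qed.
Let TB x y : T (x - y) = T x - T y.
Proof. by rewrite TD TN. Qed.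
Let T_proj e : proj e -> 0 <= T e.
Proof. by move=> [se ee]; rewrite -ee -{1}se. Qed.
Let tr1 : tr (1 : M) = 1.
Proof. by rewrite /tr trace1. Qed.
Let tr_ge0 e : proj e -> 0 <= tr e.
Proof. by move=> pe; rewrite tr_proj// sqnorm2_ge0. Qed.
Let trZ (c : R) x : tr (c%:C *: x) = c * tr x.
Proof. by rewrite /tr traceZ; case: (trace x) => a b /=; rewrite mul0r subr0. Qed.

(* Called the discrepancy below. *)
Let D x := T x - tr x.
Let DD x y : D (x + y) = D x + D y.
Proof. by rewrite /D TD trD opprD addrACA. Qed.
Let DB x y : D (x - y) = D x - D y.
Proof. by rewrite /D TB trB; lra. Qed.
Let D1 : D 1 = 0.
Proof. by rewrite /D T1 tr1 subrr. Qed.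
Let DZ (c : R) x : D (c%:C *: x) = c * D x.
Proof. by rewrite /D TZ trZ mulrBr. Qed.
Let D_projI v : D (v * star v) = D (star v * v).
Proof. by rewrite /D TC tr_projI. Qed.

Lemma proj_sub e f : proj e -> proj f -> e * f = f -> proj (e - f).
Proof.
move=> [se ee] [sf ff] ef; split; first by rewrite star_B se sf.
have fe : f * e = f by rewrite -{1}sf -{1}se -starM ef.
by rewrite mulrBr !mulrBl ee ef fe ff subrr subr0.
Qed.

(** Orthogonal copies of p are added one by one; the next one fits into 1 - s, for s
the sum of the previous ones, by comparison. *)
Lemma copies p k : proj p -> tr p *+ k <= 1 ->
  exists s, [/\ proj s, tr s = tr p *+ k & D s = D p *+ k].
Proof.
move=> pp; elim: k => [_|k IH hk].
  by exists 0; split; [exact: proj0|rewrite /tr (raddf0 (@trace R M))|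
    rewrite -(subrr 1) DB subrr].
have [|s [ps trs Ds]] := IH.
  by apply: le_trans hk; rewrite mulrSr lerDl tr_ge0.
have [|v [vv sv pv]] := proj_embed M_factor pp (projC ps).
  by rewrite trB tr1 trs lerBrDl -mulrSr.
have [ss s2] := ps; have [sf ff] := pisom_ran pv.
have s0 : s * (v * star v) = 0.
  by rewrite -sv !mulrA mulrBr mulr1 s2 subrr !mul0r.
have s0' : v * star v * s = 0.
  by have := congr1 star s0; rewrite !starM starK ss star_0.
exists (s + v * star v); split.
- split; first by rewrite starD ss sf.
  by rewrite mulrDr !mulrDl s2 ff s0 s0' addr0 add0r.
- by rewrite trD tr_projI vv trs mulrSr.
- by rewrite DD D_projI vv Ds mulrSr.
Qed.

(** Euclid's algorithm on traces: the discrepancy of p is not lost by passing to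
the remainder of 1 by copies of p, or by cutting this remainder off p. *)
Lemma halving p : proj p -> 0 < tr p ->
  exists s, [/\ proj s, tr s <= tr p / 2 & `|D p| <= `|D s|].
Proof.
move=> pp t0; have [sp pp2] := pp.
have tp1 : tr p <= 1 by rewrite -subr_ge0 -{1}tr1 -trB; exact/tr_ge0/projC.
have ub k : tr p *+ k <= 1 -> (k <= Num.bound (1 / tr p))%N.
  move=> hk; have := archi_boundP (divr_ge0 (ler01) (ltW t0)).
  rewrite ltr_pdivrMr// mulr_natl => h.
  by have := le_lt_trans hk h; rewrite ltr_pMn2l// => /ltnW.
have ex : exists k, tr p *+ k <= 1 by exists 1%N.
(* K copies of p fit into 1, and the remainder 1 - s has smaller trace than p. *)
case: (ex_maxnP ex ub) => K hK maxK.
have K1 : (0 < K)%N by exact: maxK.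
have [s [ps trs Ds]] := copies pp hK.
have pr : proj (1 - s) := projC ps.
have Dr : D (1 - s) = - (D p *+ K) by rewrite DB D1 Ds sub0r.
have trr : tr (1 - s) = 1 - tr p *+ K by rewrite trB tr1 trs.
have rp : tr (1 - s) < tr p.
  rewrite trr ltrBlDl -mulrSr ltNge; apply/negP => /maxK.
  by rewrite ltnn.
have [h|h] := leP (tr (1 - s)) (tr p / 2).
  exists (1 - s); split => //; rewrite Dr normrN normrMn.
  by rewrite -[leLHS]mulr1n ler_wpMn2l.
(* Otherwise the remainder is copied into p and removed from p. *)
have [v [vv pv piv]] := proj_embed M_factor pr pp (ltW rp).
have pf := pisom_ran piv.
exists (p - v * star v); split.
- by apply: proj_sub => //; rewrite mulrA pv.
- by rewrite trB tr_projI vv; lra.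
- rewrite DB D_projI vv Dr opprK -mulrS normrMn.
  by rewrite -[leLHS]mulr1n ler_wpMn2l.
Qed.

(** Halving p repeatedly keeps the discrepancy and makes the trace as small as
desired. But then n copies of the small projection fit into 1, for a large n, which
bounds its discrepancy by 1/n. *)
Lemma proj_unique p : proj p -> D p = 0.
Proof.
move=> pp; apply/eqP; rewrite -normr_eq0 eq_le normr_ge0 andbT leNgt.
apply/negP => d0; set d := `|D p| in d0.
have iter m : exists s, [/\ proj s, tr s * 2 ^+ m <= 1 & d <= `|D s|].
  elim: m => [|m [s [ps ts ds]]].
    exists p; split => //; rewrite mulr1 -subr_ge0 -{1}tr1 -trB.
    exact/tr_ge0/projC.
  have s0 : 0 < tr s.
    rewrite lt_neqAle tr_ge0// andbT eq_sym; apply: contraTneq d0 => s0.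
    have := s0; rewrite tr_proj// => /sqnorm2_eq0 E.
    by move: ds; rewrite E -(subrr 1) DB subrr normr0 -leNgt.
  have [s' [ps' ts' ds']] := halving ps s0.
  exists s'; split => //; last exact: le_trans ds'.
  apply: le_trans ts; rewrite exprS mulrA ler_wpM2r ?exprn_ge0//.
  by move: ts'; lra.
have := archi_boundP (divr_ge0 (ler01) (ltW d0)); set n := Num.bound _.
rewrite ltr_pdivrMr// => nd.
have [s [ps ts ds]] := iter n.
have tn : tr s *+ n <= 1.
  apply: le_trans ts; rewrite -[_ *+ n]mulr_natr ler_wpM2l ?tr_ge0//.
  by rewrite -natrX ler_nat ltnW// ltn_expl.
have [s' [ps' trs' Ds']] := copies ps tn.
have T0' : 0 <= T s' by exact: T_proj.
have T1' : 0 <= T (1 - s') by exact/T_proj/projC.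
have t0' : 0 <= tr s' by exact: tr_ge0.
have t1' : 0 <= tr (1 - s') by exact/tr_ge0/projC.
have : `|D s'| <= 1.
  by rewrite ler_norml /D; rewrite TB T1 in T1'; rewrite trB tr1 in t1'; apply/andP; lra.
rewrite Ds' normrMn -[_ *+ n]mulr_natl leNgt => /negP; apply.
by apply: lt_le_trans nd _; rewrite ler_wpM2l.
Qed.

(** One step of the dyadic expansion of x. The phase v of y = 2 x - 1 is the sign of
y, and p = (v^2 + v) / 2 is the spectral projection of x for ]1/2, 1]. *)
Lemma dyadic_step x : pos x -> pos (1 - x) -> exists p,
  [/\ proj p, pos (2%:C *: x - p) & pos (1 - (2%:C *: x - p))].
Proof.
move=> px px1; have [sx _] := px; set y := 2%:C *: x - 1.
have sy : star y = y by rewrite star_B star_1 star_Zr sx.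
have x2 : 2%:C *: x = 1 + y by rewrite /y addrC subrK.
have x2' : 2%:C *: (1 - x) = 1 - y.
  by rewrite scalerBr x2 opprD addrA -[2]/(1 + 1) rmorphD rmorph1 scalerDl scale1r addrK.
clearbody y; have [v [v1 v2 v3 _ [_ _ v4]]] := polar y.
have sv : star v = v by exact: v4.
rewrite sv in v1 v2 v3.
have yv : y * v = v * y by case: v3 => <- _; rewrite starM sy sv.
have [e eE] : exists e, e = v * v by exists (v * v).
rewrite -eE in v1 v2.
have se : star e = e by rewrite eE starM sv.
have ve : v * e = v by rewrite eE mulrA -eE.
have ee : e * e = e by rewrite {2}eE mulrA v1 -eE.
have h0 : (2^-1 + 2^-1 : R) = 1 by lra.
(* p and n carry the positive and the negative part of y. *)
pose p := (2^-1)%:C *: (e + v); pose n := (2^-1)%:C *: (e - v).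
have hh z : (2^-1)%:C *: z + (2^-1)%:C *: z = z.
  by rewrite -scalerDl -rmorphD /= h0 scale1r.
have pn : p + n = e.
  by rewrite /p /n -scalerDr addrACA subrr addr0 scalerDr hh.
have sp : star p = p by rewrite star_Zr starD se sv.
have sn : star n = n by rewrite star_Zr star_B se sv.
have vp : v * p = p by rewrite -scalerAr mulrDr ve -eE addrC.
have vn : v * n = - n by rewrite -scalerAr mulrBr ve -eE -scalerN opprB.
have ep : e * p = p by rewrite eE -mulrA vp vp.
have en : e * n = n by rewrite eE -mulrA vn mulrN vn opprK.
have pe : p * e = p by rewrite -{1}sp -{1}se -starM ep sp.
have ne : n * e = n by rewrite -{1}sn -{1}se -starM en sn.
have pv : p * v = p by rewrite -{1}sp -{1}sv -starM vp sp.
have nv : n * v = - n by rewrite -{1}sn -{1}sv -starM vn star_N sn.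
have pp : p * p = p by rewrite {2}/p -scalerAr mulrDr pe pv scalerDr hh.
have nn : n * n = n by rewrite {2}/n -scalerAr mulrBr ne nv opprK scalerDr hh.
have ye : y * e = e * y by rewrite eE -[RHS]mulrA -yv [RHS]mulrA -yv -[RHS]mulrA.
have yp : y * p = p * y.
  by rewrite /p -[LHS]scalerAr -[RHS]scalerAl mulrDl mulrDr yv ye.
have yn : y * n = n * y.
  by rewrite /n -[LHS]scalerAr -[RHS]scalerAl mulrBl mulrBr yv ye.
have ppy : pos (p * y).
  have := pos_conj p v3; rewrite sp mulrA pv -mulrA yp mulrA pp.
  by [].
have pny : pos (- (n * y)).
  have := pos_conj n v3; rewrite sn mulrA nv -mulrA yn mulrA.
  by rewrite mulNr nn mulNr.
have yE : y = p * y + n * y by rewrite -mulrDl pn.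
have prp : proj p by [].
have spC : star (1 - p) = 1 - p by case: (projC prp).
exists p; split => //.
  have -> : 2%:C *: x - p = p * y + (1 - p) * (2%:C *: x) * (1 - p).
    rewrite x2.
    have y1p : (1 - p) * (1 + y) * (1 - p) = (1 - p) * (1 + y).
      rewrite -mulrA [(1 + y) * _](_ : _ = (1 - p) * (1 + y)).
        by rewrite mulrA; case: (projC prp) => _ ->.
      by rewrite mulrBl mulrBr mul1r mulr1 mulrDl mulrDr mul1r mulr1 yp.
    by rewrite y1p mulrBl mul1r mulrDr mulr1 opprD [RHS]addrC !addrA subrK.
  apply: posD => //; rewrite -[X in X * _ * _]spC; apply: pos_conj.
  exact: posZ.
have -> : 1 - (2%:C *: x - p) = p * (2%:C *: (1 - x)) * p + - (n * y).
  rewrite x2' x2.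
  have -> : p * (1 - y) * p = p - p * y.
    by rewrite mulrBr mulr1 mulrBl pp -mulrA yp mulrA pp.
  by rewrite -[RHS]addrA -opprD -yE -(addrA 1) opprD addrA subrr sub0r opprB.
apply: posD => //; rewrite -[X in X * _ * _]sp; apply: pos_conj.
exact: posZ.
Qed.

Lemma unit_interval_bound x : pos x -> pos (1 - x) -> `|D x| <= 1.
Proof.
have T01 z : pos z -> pos (1 - z) -> 0 <= T z /\ 0 <= tr z.
  move=> pz pz1; have [s [ss _] <-] := pos_sqrt1 pz pz1.
  by rewrite -{1 3}ss; split; [exact: T_ge0|exact: sqnorm2_ge0].
move=> px px1; have [a1 a2] := T01 _ px px1.
have [||] := T01 (1 - x) => //; first by rewrite opprB addrC subrK.
rewrite TB T1 trB tr1 => b1 b2; rewrite ler_norml /D; apply/andP; lra.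
Qed.

(** Each step of the dyadic expansion doubles the discrepancy, which stays bounded. *)
Lemma unit_interval_unique x : pos x -> pos (1 - x) -> D x = 0.
Proof.
have h n : forall x, pos x -> pos (1 - x) -> `|D x| * 2 ^+ n <= 1.
  elim: n => [|n IH] z pz pz1; first by rewrite mulr1 unit_interval_bound.
  have [p [pp h1 h2]] := dyadic_step pz pz1.
  have := IH _ h1 h2; rewrite DB DZ (proj_unique pp) subr0 normrM normr_nat.
  by rewrite exprS mulrCA mulrA.
move=> px px1; apply/eqP; rewrite -normr_eq0 eq_le normr_ge0 andbT leNgt.
apply/negP => d0.
have := archi_boundP (divr_ge0 (ler01) (ltW d0)); set n := Num.bound _.
rewrite ltr_pdivrMr// mulrC ltNge => /negP; apply.
apply: le_trans (h n _ px px1); rewrite ler_wpM2l//.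
by rewrite -natrX ler_nat ltnW// ltn_expl.
Qed.

(** By scaling and translation, a self-adjoint operator is brought between 0 and 1,
where its dyadic expansion applies. *)
Lemma unique_trace x : T x = tr x.
Proof.
suff Dsa z : star z = z -> D z = 0.
  have : D (x + star x) = 0 by apply: Dsa; rewrite starD starK addrC.
  rewrite DD /D T_star /tr trace_star.
  have -> : complex.Re (trace x)^* = complex.Re (trace x) by case: (trace x).
  by lra.
move=> sz; have [K K0 /op_boundedP hK] := op_bounded_exists z.
have zK (v : vnspace M) : `|rip (rep z v) v| <= K * rip v v.
  apply: le_trans (rip_CS _ _) _; rewrite rip_hnorm expr2 mulrA.
  by rewrite ler_wpM2r ?hnorm_ge0.
have pz y : star y = y -> (forall v : vnspace M, - rip (rep y v) v <= K * rip v v) ->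
    pos ((2^-1 / K)%:C *: (K%:C%:A + y)).
  move=> sy yK; apply: posZ; first by rewrite divr_ge0 ?invr_ge0// ltW.
  split=> [|v]; first by rewrite starD star_Zr star_1 sy.
  by rewrite repD repZ rep1 ripDl ripZl; have := yK v; lra.
have p1 : pos ((2^-1 / K)%:C *: (K%:C%:A + z)).
  by apply: pz => // v; have /ler_normlP[] := zK v.
have p2 : pos (1 - (2^-1 / K)%:C *: (K%:C%:A + z)).
  have : pos ((2^-1 / K)%:C *: (K%:C%:A + - z)).
    apply: pz => [|v]; first by rewrite star_N sz.
    by rewrite repN ripNl opprK; have /ler_normlP[] := zK v.
  congr pos; rewrite !scalerDr scalerN opprD addrA; congr (_ - _).
  rewrite scalerA -(rmorphM (real_complex R)) divfK ?gt_eqF//.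
  apply/eqP; rewrite eq_sym subr_eq -scalerDl -rmorphD /=.
  have -> : (2^-1 + 2^-1 : R) = 1 by lra.
  by rewrite scale1r.
have := unit_interval_unique p1 p2; rewrite DZ DD DZ D1 mulr0 add0r => /eqP.
rewrite mulf_eq0 => /orP[|/eqP//]; rewrite mulf_eq0 !invr_eq0 pnatr_eq0 /=.
by rewrite gt_eqF.
Qed.
End UniqueTrace.

(** * Suprema of directed families *)

Section DirectedSup.
Context {R : realType} {N : vonNeumannType R}.
Implicit Types (x y a b s : N) (v w : vnspace N).

Lemma ip_ge0P x v :
  0 <= ip (rep x v) v <-> rip (rep x v) ('i *: v) = 0 /\ 0 <= rip (rep x v) v.
Proof.
rewrite (ip_rip (rep x v)) lecE /=; split => [/andP[/eqP -> ->]|[-> ->]] //.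
by rewrite eqxx.
Qed.

(** By polarization, since x^* - x has the zero form. *)
Lemma form_real_sa x : (forall v, 0 <= ip (rep x v) v) -> star x = x.
Proof.
move=> h; apply/eqP; rewrite -subr_eq0; set d := star x - x.
have d0 v : ip (rep d v) v = 0.
  rewrite repB ipDl ipNl rep_star ipC; have := h v.
  rewrite lecE; case: (ip _ _) => p q /= /andP[/eqP -> _].
  by simpc.
apply/eqP/rep_inj => v; apply: rip_ext => u; rewrite rip0l.
have e1 : ip (rep d v) u + ip (rep d u) v = 0.
  have := d0 (v + u); rewrite linearD ipDl !ipDr !d0 add0r addr0.
  by [].
have e2 : ip (rep d u) v = ip (rep d v) u.
  have := d0 (v + 'i *: u).
  rewrite linearD linearZ /= ipDl !ipDr !ipZl !ipZr !d0 !mulr0 add0r addr0.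
  case: (ip (rep d v) u) (ip (rep d u) v) => [p q] [p' q'] E.
  have := congr1 (@complex.Re R) E; have := congr1 (@complex.Im R) E => /= h1 h2.
  by congr Complex; lra.
by move: e1; rewrite e2 /rip; case: (ip _ _) => p q [] /=; lra.
Qed.

Lemma le_op_pos x y : le_op x y -> pos (y - x).
Proof.
move=> h; split=> [|v]; first exact: form_real_sa.
by have /ip_ge0P[] := h v.
Qed.

Lemma pos_le_op x y : pos (y - x) -> le_op x y.
Proof.
move=> [sx px] v; apply/ip_ge0P; split => //.
have := rep_star (y - x) v v; rewrite sx [RHS]ipC /rip ipZr.
by case: (ip _ _) => p q /= []; rewrite mul0r sub0r mulN1r opprK => h; lra.
Qed.

Lemma le_op_trans x y z : le_op x y -> le_op y z -> le_op x z.
Proof.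
move=> /le_op_pos h /le_op_pos k; apply: pos_le_op.
by rewrite -(subrK y z) -addrA; exact: posD.
Qed.

(** Vigier's theorem: a bounded directed family converges strongly, because the
squared norms of its increments are dominated by increments of bounded monotone
forms. The limit is an upper bound, hence lies above the supremum s. *)
Lemma directed_sup_form (D : set N) s : D !=set0 ->
  (forall a b, D a -> D b -> exists2 c, D c & le_op a c /\ le_op b c) ->
  is_sup_op D s ->
  forall v (e : R), 0 < e ->
    exists2 a, D a & rip (rep s v) v - e < rip (rep a v) v.
Proof.
move=> [a0 Da0] dir [ub lub].
pose B a := [set b | D b /\ le_op a b].
(* The filter of the tails of D, for the operator order. *)
pose F := filter_from D B.
have FF : ProperFilter F.
  apply: filter_from_proper; last by move=> a Da; exists a; split => //; exact: le_op_refl.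
  apply: filter_from_filter; first by exists a0.
  move=> a b Da Db; have [c Dc [ac bc]] := dir a b Da Db; exists c => // d [Dd cd].
  by split; split => //; apply: le_op_trans cd.
have nearB a : D a -> \forall b \near F, D b /\ le_op a b by move=> Da; exists a.
have [C C0 /op_boundedP hC] := op_bounded_exists (s - a0).
have formC a b w : le_op a0 a -> le_op a b -> D b ->
    rip (rep (b - a) w) w <= C * hnorm w ^+ 2.
  move=> a0a ab Db; apply: (@le_trans _ _ (rip (rep (s - a0) w) w)).
    apply: pos_le; have /le_op_pos h1 := ub _ Db; have /le_op_pos h2 := a0a.
    have -> : s - a0 - (b - a) = (s - b) + (a - a0) by rewrite opprB [a - b]addrC addrACA [- a0 + a]addrC.
    exact: posD.
  apply: le_trans (ler_norm _) _; apply: le_trans (rip_CS _ _) _.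
  by rewrite expr2 mulrA ler_wpM2r ?hnorm_ge0.
have sqC a b w : le_op a0 a -> le_op a b -> D b ->
    hnorm (rep (b - a) w) ^+ 2 <= C * rip (rep (b - a) w) w.
  move=> a0a ab Db; apply: pos_sqnorm => // [|u]; first exact: le_op_pos.
  exact: formC.
have [K0 K00 hK0] := op_bounded_exists a0.
have [y hy] : exists y, scvg F id y.
  apply: (@strong_limit _ _ _ _ _ (C + K0)).
    apply: filterS (nearB _ Da0) => b [Db a0b].
    rewrite -(subrK a0 b); apply: op_boundedD => //; apply/op_boundedP => w.
    rewrite -ler_sqr ?nnegrE ?mulr_ge0 ?hnorm_ge0 ?(ltW C0)//.
    apply: le_trans (sqC _ _ _ _ a0b Db) _; first exact: le_op_refl.
    rewrite exprMn [C ^+ 2]expr2 -mulrA ler_pM2l//; apply: formC => //.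
    exact: le_op_refl.
  move=> v e e0; pose S := [set rip (rep a v) v | a in B a0].
  have Sne : S !=set0 by exists (rip (rep a0 v) v), a0 => //; split => //; exact: le_op_refl.
  have supS : has_sup S.
    split => //; exists (rip (rep s v) v) => _ [a [Da _] <-].
    by apply: pos_le; apply: le_op_pos; exact: ub.
  have e2 : 0 < e ^+ 2 / C by rewrite divr_gt0// exprn_gt0.
  have [_ [a1 [Da1 a01] <-] h1] := sup_adherent e2 supS.
  exists (rep a1 v); apply: filterS (nearB _ Da1) => b [Db a1b].
  rewrite hnorm_sub -repB -ltr_sqr ?nnegrE ?hnorm_ge0 ?(ltW e0)//.
  apply: le_lt_trans (sqC _ _ _ a01 a1b Db) _; rewrite mulrC -ltr_pdivlMr//.
  have hb : rip (rep b v) v <= sup S.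
    apply: ub_le_sup; first by case: supS.
    by exists b => //; split => //; exact: le_op_trans a1b.
  by rewrite repB ripBl; lra.
have ay a : D a -> le_op a y.
  move=> Da v; have hB := nearB _ Da; apply/ip_ge0P; split.
    apply: (cvg_unique _ (scvg_rip (v := v) (w := 'i *: v) (scvgB hy (scvg_cst a)))).
      exact: Rhausdorff.
    apply: cvg_near_cst; apply: filterS hB => b [_ ab].
    by have /ip_ge0P[] := ab v.
  apply: (closed_cvg (fun r : R => 0 <= r) _ _ _
    (scvg_rip (v := v) (w := v) (scvgB hy (scvg_cst a)))); first exact: closed_ge.
  by apply: filterS hB => b [_ ab]; have /ip_ge0P[] := ab v.
move=> v e e0; have /le_op_pos sy := lub _ ay.
have h1 : rip (rep s v) v - e < rip (rep y v) v by have := pos_le v sy; lra.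
have [b [[Db _] hb]] : exists b, (D b /\ le_op a0 b) /\ rip (rep s v) v - e < rip (rep b v) v.
  apply: (@filter_ex _ F); apply: filterI; first exact: nearB.
  have h2 : (fun b => rip (rep b v) v) @ F --> rip (rep y v) v by exact: scvg_rip hy.
  exact: (cvgr_gt _ h2).
by exists b.
Qed.
End DirectedSup.

(** * Finite powers of a Hilbert space *)

Section HilbertPower.
Context {R : realType} (H : hilbertType R) (n : nat).

(** The Hilbert sum of n+1 copies of H. *)
Definition hpow := {ffun 'I_n.+1 -> H}.
HB.instance Definition _ := GRing.Lmodule.on hpow.

Implicit Types (u v w : hpow) (c : R).

Definition hpow_ip v w : R[i] := \sum_i ip (v i) (w i).
Definition hpow_sq v : R := \sum_i hnorm (v i) ^+ 2.
Definition hpow_rip v w : R := \sum_i rip (v i) (w i).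
Definition hpow_norm v : R[i] := (Num.sqrt (hpow_sq v))%:C.

Fact hpow_sq_ge0 v : 0 <= hpow_sq v.
Proof. by apply: sumr_ge0 => i _; rewrite sqr_ge0. Qed.

Fact hpow_sq_eq0 v : hpow_sq v = 0 -> v = 0.
Proof.
move=> /eqP; rewrite psumr_eq0 => [/allP h|i _]; last exact: sqr_ge0.
apply/ffunP => i; rewrite ffunE; apply: hnorm_eq0; apply/eqP.
by rewrite -sqrf_eq0; have := h i (mem_index_enum i).
Qed.

Fact hpow_sqD v w : hpow_sq (v + w) = hpow_sq v + 2 * hpow_rip v w + hpow_sq w.
Proof.
rewrite /hpow_sq /hpow_rip mulr_sumr -!big_split /=; apply: eq_bigr => i _.
by rewrite ffunE -!rip_hnorm ripDl !ripDr (ripC (w i)); lra.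
Qed.

Fact hpow_sqZ c v : hpow_sq (c%:C *: v) = c ^+ 2 * hpow_sq v.
Proof.
rewrite /hpow_sq mulr_sumr; apply: eq_bigr => i _.
by rewrite ffunE hnormZ exprMn real_normK ?num_real.
Qed.

Fact hpow_ripZ c v w : hpow_rip v (c%:C *: w) = c * hpow_rip v w.
Proof.
rewrite /hpow_rip mulr_sumr; apply: eq_bigr => i _.
by rewrite ffunE ripZr.
Qed.

Fact hpow_CS v w : hpow_rip v w <= Num.sqrt (hpow_sq v) * Num.sqrt (hpow_sq w).
Proof.
have [w0|w0] := eqVneq (hpow_sq w) 0.
  rewrite (hpow_sq_eq0 w0) /hpow_rip big1 ?mulr_ge0 ?sqrtr_ge0// => i _.
  by rewrite ffunE rip0r.
have nw : 0 < hpow_sq w by rewrite lt_neqAle eq_sym w0 hpow_sq_ge0.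
apply: le_trans (ler_norm _) _.
rewrite -ler_sqr ?nnegrE ?mulr_ge0 ?sqrtr_ge0//.
rewrite real_normK ?num_real// exprMn !sqr_sqrtr ?hpow_sq_ge0//.
set S := hpow_rip v w; pose t := S / hpow_sq w.
have := hpow_sq_ge0 (v + (- t)%:C *: w).
rewrite hpow_sqD hpow_sqZ hpow_ripZ -/S sqrrN.
have E : t * hpow_sq w = S by rewrite /t divfK.
rewrite expr2 -mulrA E => h.
have {h} : t * S <= hpow_sq v by lra.
by rewrite -(ler_pM2r nw) mulrAC E expr2.
Qed.

Fact hpow_normD v w : hpow_norm (v + w) <= hpow_norm v + hpow_norm w.
Proof.
rewrite /hpow_norm -(rmorphD (real_complex R)) lecR.
rewrite -ler_sqr ?nnegrE ?addr_ge0 ?sqrtr_ge0//.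
rewrite sqrrD !sqr_sqrtr ?hpow_sq_ge0// hpow_sqD.
by rewrite lerD2r lerD2l mulr_natl ler_pMn2r// hpow_CS.
Qed.

Fact hpow_normZ (a : R[i]) v : hpow_norm (a *: v) = `|a| * hpow_norm v.
Proof.
have aE : `|a| = (complex.Re `|a|)%:C.
  by have := normr_ge0 a; rewrite lecE; case: (`|a|) => ? ? /= /andP[/eqP ->].
have a0 : 0 <= complex.Re `|a| by rewrite -lecR -aE normr_ge0.
rewrite aE -(rmorphM (real_complex R)); congr (_%:C).
rewrite -[in RHS](ger0_norm a0) -[in RHS]sqrtr_sqr -sqrtrM ?sqr_ge0//.
congr Num.sqrt; rewrite /hpow_sq mulr_sumr; apply: eq_bigr => i _.
rewrite -exprMn ffunE; congr (_ ^+ 2).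
by apply/(@complexI R); rewrite rmorphM /= -!hnormE normrZ -aE.
Qed.

Fact hpow_norm0_eq0 v : hpow_norm v = 0 -> v = 0.
Proof.
move=> [] /eqP; rewrite sqrtr_eq0 => h; apply: hpow_sq_eq0.
by apply/eqP; rewrite eq_le h hpow_sq_ge0.
Qed.

HB.instance Definition _ := Lmodule_isNormed.Build R[i] hpow
  hpow_normD hpow_normZ hpow_norm0_eq0.

Fact hpow_normE v : `|v| = hpow_norm v. Proof. by []. Qed.

Fact hnorm_le_hpow v i : (hnorm (v i))%:C <= `|v|.
Proof.
rewrite hpow_normE /hpow_norm lecR -[leLHS]ger0_norm ?hnorm_ge0// -sqrtr_sqr.
rewrite ler_sqrt ?hpow_sq_ge0// /hpow_sq (bigD1 i)//= lerDl.
by apply: sumr_ge0 => j _; rewrite sqr_ge0.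
Qed.

Fact hpow_le_sum v : `|v| <= (\sum_i hnorm (v i))%:C.
Proof.
rewrite hpow_normE /hpow_norm lecR.
have s0 : 0 <= \sum_i hnorm (v i) by apply: sumr_ge0 => i _; exact: hnorm_ge0.
rewrite -(ger0_norm s0) -sqrtr_sqr ler_sqrt ?sqr_ge0// /hpow_sq expr2 mulr_suml.
apply: ler_sum => i _; rewrite expr2 ler_wpM2l ?hnorm_ge0//.
rewrite (bigD1 i)//= lerDl; apply: sumr_ge0 => j _; exact: hnorm_ge0.
Qed.

Fact hpow_complete (F : set_system hpow) : ProperFilter F -> cauchy F -> cvg F.
Proof.
move=> FF /cauchyP Fc.
have /choice[l hl] i : exists l, hcvg F (fun v : hpow => v i) l.
  apply: hcvg_complete => e e0; have e0' : (0 : R[i]) < e%:C by rewrite ltcR.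
  have [v hv] := Fc _ e0'; exists (v i); apply: filterS hv => w.
  rewrite -ball_normE /= => h; have := le_lt_trans (hnorm_le_hpow (v - w) i) h.
  by rewrite ltcR !ffunE.
apply/cvg_ex; exists ([ffun i => l i] : hpow).
apply/cvgrPdist_lt => e /complex_gt0[e0 eE].
have n0 : 0 < complex.Re e / n.+1%:R by rewrite divr_gt0.
have : F [set w : hpow | forall i, hnorm (l i - w i) < complex.Re e / n.+1%:R].
  by apply: filter_forall => i; exact: hl.
apply: filterS => w hw; apply: le_lt_trans (hpow_le_sum _) _.
rewrite eE ltcR; have -> : complex.Re e = \sum_(i < n.+1) complex.Re e / n.+1%:R.
  by rewrite sumr_const card_ord -[RHS]mulr_natr divfK// pnatr_eq0.
apply: ltr_sum => [|i _]; first by apply/hasP; exists ord0; rewrite ?mem_index_enum.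
by rewrite !ffunE.
Qed.
HB.instance Definition _ := Uniform_isComplete.Build hpow hpow_complete.

Fact hpow_ip_linear (a : R[i]) u v w :
  hpow_ip (a *: u + v) w = a * hpow_ip u w + hpow_ip v w.
Proof.
rewrite /hpow_ip mulr_sumr -big_split /=; apply: eq_bigr => i _.
by rewrite !ffunE ip_linear.
Qed.
Fact hpow_ipC v w : hpow_ip w v = (hpow_ip v w)^*.
Proof.
by rewrite /hpow_ip rmorph_sum; apply: eq_bigr => i _; rewrite ipC.
Qed.
Fact hpow_ip_norm v : hpow_ip v v = `|v| ^+ 2.
Proof.
rewrite hpow_normE /hpow_norm -rmorphXn /= sqr_sqrtr ?hpow_sq_ge0//.
by rewrite /hpow_ip /hpow_sq rmorph_sum; apply: eq_bigr => i _; rewrite ip_hnorm.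
Qed.
HB.instance Definition _ := NormedModule_isHilbert.Build R hpow
  hpow_ip_linear hpow_ipC hpow_ip_norm.
End HilbertPower.

(** * Matrices over a tracial von Neumann algebra *)

Section MatrixAlgebra.
Context {R : realType} (M : tracialVNType R) (n : nat).

(** An alias, as the matrices over M already have a module structure over M, which
is not the one over the complex numbers. *)
Definition mxM := 'M[M]_n.+1.
HB.instance Definition _ := GRing.NzRing.on mxM.

Implicit Types (A B : mxM).
Local Notation H := (hpow (vnspace M) n).

Definition mx_scale (a : R[i]) A : mxM := \matrix_(i, j) (a *: A i j).

Fact mx_scaleA a b A : mx_scale a (mx_scale b A) = mx_scale (a * b) A.
Proof. by apply/matrixP => i j; rewrite !mxE scalerA. Qed.
Fact mx_scale1 : left_id 1 mx_scale.
Proof. by move=> A; apply/matrixP => i j; rewrite !mxE scale1r. Qed.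
Fact mx_scaleDr : right_distributive mx_scale +%R.
Proof. by move=> a A B; apply/matrixP => i j; rewrite !mxE scalerDr. Qed.
Fact mx_scaleDl A : {morph mx_scale^~ A : a b / a + b}.
Proof. by move=> a b; apply/matrixP => i j; rewrite !mxE scalerDl. Qed.
HB.instance Definition _ := GRing.Zmodule_isLmodule.Build R[i] mxM
  mx_scaleA mx_scale1 mx_scaleDr mx_scaleDl.

Fact mxME A B i j : (A * B) i j = \sum_k A i k * B k j.
Proof. by rewrite mxE. Qed.
Fact mxZE (a : R[i]) A i j : (a *: A) i j = a *: A i j.
Proof. by rewrite mxE. Qed.

Fact mx_scaleAl (a : R[i]) A B : a *: (A * B) = (a *: A) * B.
Proof.
apply/matrixP => i j; rewrite mxZE !mxME scaler_sumr; apply: eq_bigr => k _.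
by rewrite mxZE scalerAl.
Qed.
HB.instance Definition _ := GRing.Lmodule_isLalgebra.Build R[i] mxM mx_scaleAl.
Fact mx_scaleAr (a : R[i]) A B : a *: (A * B) = A * (a *: B).
Proof.
apply/matrixP => i j; rewrite mxZE !mxME scaler_sumr; apply: eq_bigr => k _.
by rewrite mxZE scalerAr.
Qed.
HB.instance Definition _ := GRing.Lalgebra_isAlgebra.Build R[i] mxM mx_scaleAr.

Definition mx_star A : mxM := \matrix_(i, j) star (A j i).
Fact mx_starK : involutive mx_star.
Proof. by move=> A; apply/matrixP => i j; rewrite !mxE starK. Qed.
Fact mx_starD : {morph mx_star : A B / A + B}.
Proof. by move=> A B; apply/matrixP => i j; rewrite !mxE starD. Qed.
Fact mx_starZ (a : R[i]) A : mx_star (a *: A) = a^* *: mx_star A.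
Proof. by apply/matrixP => i j; rewrite !mxE starZ. Qed.
Fact mx_starM A B : mx_star (A * B) = mx_star B * mx_star A.
Proof.
apply/matrixP => i j; rewrite mxE !mxME.
rewrite (big_morph (@star R M) (@starD R M) (@star_0 R M)).
by apply: eq_bigr => k _; rewrite starM !mxE.
Qed.
HB.instance Definition _ := Algebra_isStar.Build R mxM
  mx_starK mx_starD mx_starZ mx_starM.

Fact mx_starE A i j : (star A) i j = star (A j i).
Proof. by rewrite mxE. Qed.

Definition mx_trace A : R[i] := (n.+1%:R)^-1 * \sum_i trace (A i i).

Let nV0 : 0 < (n.+1%:R : R[i])^-1. Proof. by rewrite invr_gt0 ltr0n. Qed.

Fact mx_trace_linear (a : R[i]) A B : mx_trace (a *: A + B) = a * mx_trace A + mx_trace B.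
Proof.
rewrite /mx_trace mulrCA -mulrDr [a * _]mulr_sumr -big_split; congr (_ * _).
by apply: eq_bigr => i _ /=; rewrite mxE mxZE trace_linear.
Qed.
Fact mx_trace1 : mx_trace 1 = 1.
Proof.
rewrite /mx_trace (eq_bigr (fun=> 1)) => [|i _]; last by rewrite mxE eqxx trace1.
by rewrite sumr_const card_ord mulVf// pnatr_eq0.
Qed.
Fact mx_traceC A B : mx_trace (A * B) = mx_trace (B * A).
Proof.
rewrite /mx_trace; congr (_ * _).
under eq_bigr do rewrite mxME raddf_sum /=.
under [RHS]eq_bigr do rewrite mxME raddf_sum /=.
rewrite exchange_big; apply: eq_bigr => i _; apply: eq_bigr => j _.
exact: traceC.
Qed.
Fact mx_trace_sq A : \sum_i trace ((star A * A) i i) =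
  \sum_i \sum_k trace (star (A k i) * A k i).
Proof.
apply: eq_bigr => i _; rewrite mxME raddf_sum; apply: eq_bigr => k _.
by rewrite mx_starE.
Qed.
Fact mx_trace_ge0 A : 0 <= mx_trace (star A * A).
Proof.
rewrite /mx_trace mulr_ge0 ?(ltW nV0)// mx_trace_sq.
by do 2![apply: sumr_ge0 => ? _]; exact: trace_ge0.
Qed.
Fact mx_trace_eq0 A : mx_trace (star A * A) = 0 -> A = 0.
Proof.
move=> /eqP; rewrite mulf_eq0 gt_eqF//= mx_trace_sq.
rewrite psumr_eq0 => [/allP h|i _]; last first.
  by apply: sumr_ge0 => k _; exact: trace_ge0.
apply/matrixP => k i; rewrite mxE; apply: trace_eq0.
have := h i (mem_index_enum i); rewrite psumr_eq0 => [/allP h'|j _]; last exact: trace_ge0.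
by have /eqP := h' k (mem_index_enum k).
Qed.
HB.instance Definition _ := StarAlgebra_isTracial.Build R mxM
  mx_trace_linear mx_trace1 mx_traceC mx_trace_ge0 mx_trace_eq0.

Definition mx_rep_fun A (v : H) : H := [ffun i => \sum_j rep (A i j) (v j)].
Fact mx_rep_is_linear A : linear (mx_rep_fun A).
Proof.
move=> a v w; apply/ffunP => i; rewrite !ffunE scaler_sumr -big_split /=.
by apply: eq_bigr => j _; rewrite !ffunE linearP.
Qed.
HB.instance Definition _ A :=
  GRing.isLinear.Build R[i] H H *:%R (mx_rep_fun A) (mx_rep_is_linear A).
Definition mx_rep A : {linear H -> H} := mx_rep_fun A.
Fact mx_repE A v i : mx_rep A v i = \sum_j rep (A i j) (v j).
Proof. by rewrite ffunE. Qed.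

Fact hnorm_coord (v : H) i : hnorm (v i) <= hnorm v.
Proof. by have := hnorm_le_hpow v i; rewrite [leRHS]hnormE lecR. Qed.
Fact hnorm_le_coord (v : H) : hnorm v <= \sum_i hnorm (v i).
Proof. by have := hpow_le_sum v; rewrite [leLHS]hnormE lecR. Qed.

Fact mx_rep_continuous A : continuous (mx_rep A).
Proof.
have /choice[K hK] ij : exists K : R, 0 < K /\ op_bounded K (A ij.1 ij.2).
  by have [K K0 hK] := op_bounded_exists (A ij.1 ij.2); exists K.
apply: (@bounded_continuous _ _ _ _ (\sum_i \sum_j K (i, j))) => v.
apply: le_trans (hnorm_le_coord _) _; rewrite mulr_suml; apply: ler_sum => i _.
rewrite mx_repE; apply: le_trans (hnorm_sum _) _; rewrite mulr_suml.
apply: ler_sum => j _; have [K0 /op_boundedP h] := hK (i, j).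
by apply: le_trans (h _) _; rewrite ler_pM2l//; exact: hnorm_coord.
Qed.

Fact mx_rep_linear (a : R[i]) A B v : mx_rep (a *: A + B) v = a *: mx_rep A v + mx_rep B v.
Proof.
apply/ffunP => i; rewrite !ffunE scaler_sumr -big_split; apply: eq_bigr => j _ /=.
by rewrite mxE mxZE rep_linear.
Qed.
Fact mx_repM A B v : mx_rep (A * B) v = mx_rep A (mx_rep B v).
Proof.
apply/ffunP => i; rewrite !mx_repE.
under [RHS]eq_bigr do rewrite mx_repE linear_sum /=.
rewrite exchange_big; apply: eq_bigr => j _ /=; rewrite mxME.
rewrite (big_morph (fun x : M => rep x (v j)) (fun x y => repD x y (v j)) (rep0 (v j))).
by apply: eq_bigr => k _; rewrite repM.
Qed.
Fact mx_rep1 v : mx_rep 1 v = v.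
Proof.
apply/ffunP => i; rewrite mx_repE (bigD1 i)//= mxE eqxx rep1 big1 ?addr0// => j ji.
by rewrite mxE eq_sym (negbTE ji) rep0.
Qed.
Fact mx_ipE (v w : H) : ip v w = \sum_i ip (v i) (w i). Proof. by []. Qed.

Fact mx_rep_star A v w : ip (mx_rep (star A) v) w = ip v (mx_rep A w).
Proof.
rewrite !mx_ipE; under eq_bigr do rewrite mx_repE ip_suml.
rewrite exchange_big; apply: eq_bigr => j _ /=; rewrite mx_repE ip_sumr.
by apply: eq_bigr => i _; rewrite mx_starE rep_star.
Qed.

Definition delta_vec (l : 'I_n.+1) (u : vnspace M) : H := [ffun j => if j == l then u else 0].

Fact mx_rep_delta A l u k : mx_rep A (delta_vec l u) k = rep (A k l) u.
Proof.
rewrite mx_repE (bigD1 l)//= ffunE eqxx big1 ?addr0// => j jl.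
by rewrite ffunE (negbTE jl) linear0.
Qed.
Fact ip_delta (v : H) k w : ip v (delta_vec k w) = ip (v k) w.
Proof.
rewrite mx_ipE (bigD1 k)//= ffunE eqxx big1 ?addr0// => j jk.
by rewrite ffunE (negbTE jk) ipC ip0l conjc0.
Qed.
Fact delta_sum (v : H) : v = \sum_l delta_vec l (v l).
Proof.
apply/ffunP => i; rewrite sum_ffunE (bigD1 i)//= ffunE eqxx big1 ?addr0// => j ji.
by rewrite ffunE eq_sym (negbTE ji).
Qed.
Fact delta_linear l : linear (delta_vec l).
Proof.
move=> a u w; apply/ffunP => i; rewrite !ffunE.
by case: ifP => // _; rewrite scaler0 addr0.
Qed.
Fact hnorm_delta l u : hnorm (delta_vec l u) = hnorm u.
Proof.
apply/eqP; rewrite -(@eqrXn2 _ 2)// ?hnorm_ge0//; apply/eqP.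
by rewrite -!rip_hnorm /rip ip_delta ffunE eqxx.
Qed.

Fact mx_rep_inj A : (forall v, mx_rep A v = 0) -> A = 0.
Proof.
move=> h; apply/matrixP => k l; rewrite mxE; apply: rep_inj => u.
by rewrite -mx_rep_delta h ffunE.
Qed.

(** Each matrix entry of an operator T in the closure is a weak limit of entries. *)
Fact mx_rep_wot_closed (T : {linear H -> H}) (F : set_system mxM) :
  continuous T -> ProperFilter F ->
  (forall v w,
    (fun A => ip (mx_rep A v) w : R[i]^o) @ F --> (ip (T v) w : R[i]^o)) ->
  exists A, forall v, mx_rep A v = T v.
Proof.
move=> Tc FF hF; have [K hK] := continuous_bounded Tc.
have /choice[A hA] kl : exists x : M, forall u, rep x u = T (delta_vec kl.2 u) kl.1.
  case: kl => k l /=; pose t u := T (delta_vec l u) k.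
  have t_lin : linear t.
    by move=> a u w; rewrite /t delta_linear linearP !ffunE.
  pose tl : {linear vnspace M -> vnspace M} :=
    HB.pack t (GRing.isLinear.Build _ _ _ _ t t_lin).
  have tc : continuous tl.
    apply: (@bounded_continuous _ _ _ tl K) => u.
    by apply: le_trans (hnorm_coord _ _) _; apply: le_trans (hK _) _; rewrite hnorm_delta.
  apply: (@rep_wot_closed _ _ tl ((fun A : mxM => A k l) @ F)) => [|u w].
    exact: tc.
  have := hF (delta_vec l u) (delta_vec k w); rewrite ip_delta.
  by under eq_fun do rewrite ip_delta mx_rep_delta.
exists (\matrix_(k, l) A (k, l)) => v; apply/ffunP => k; rewrite mx_repE.
rewrite [in RHS](delta_sum v) linear_sum sum_ffunE; apply: eq_bigr => l _ /=.
by rewrite mxE hA.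
Qed.

HB.instance Definition _ := StarAlgebra_isVonNeumann.Build R mxM
  mx_rep_continuous mx_rep_linear mx_repM mx_rep1 mx_rep_star mx_rep_inj
  mx_rep_wot_closed.
End MatrixAlgebra.

(** * Normality of the trace on matrices *)

Section MatrixNormal.
Context {R : realType} (M : tracialVNType R) (n : nat).
Local Notation N := (mxM M n).
Implicit Types (A B s : N).

Fact ip_rep_delta A i u w : ip (rep A (delta_vec i u)) (delta_vec i w) = ip (rep (A i i) u) w.
Proof. by rewrite ip_delta; congr ip; exact: mx_rep_delta. Qed.

Fact mxBE A B i j : (A - B) i j = A i j - B i j.
Proof. by rewrite !mxE. Qed.

Fact le_op_diag A B i : le_op A B -> le_op (A i i) (B i i).
Proof. by move=> h u; have := h (delta_vec i u); rewrite ip_rep_delta mxBE. Qed.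

(** At a vector with a single nonzero coordinate, the form of the supremum s is
approached by the forms of members of D. *)
Fact is_sup_diag (D : set N) s i : D !=set0 ->
  (forall a b, D a -> D b -> exists2 c, D c & le_op a c /\ le_op b c) ->
  is_sup_op D s -> is_sup_op [set A i i | A in D] (s i i).
Proof.
move=> D0 dir sup_s; have [ub _] := sup_s; split=> [_ [A DA <-]|t ht].
  by apply: le_op_diag; exact: ub.
have [A0 DA0] := D0.
have h0 : le_op (A0 i i) t by apply: ht; exists A0.
have k0 : le_op (A0 i i) (s i i) by apply: le_op_diag; exact: ub.
apply: pos_le_op; split.
  have [h1 _] := le_op_pos h0; have [h2 _] := le_op_pos k0.
  have -> : t - s i i = (t - A0 i i) - (s i i - A0 i i) by rewrite opprB addrA subrK.
  by rewrite star_B h1 h2.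
move=> u; rewrite repB ripBl subr_ge0; apply/ler_addgt0Pl => e e0.
have [A DA] := directed_sup_form D0 dir sup_s (delta_vec i u) e0.
rewrite /rip !ip_rep_delta -!/(rip _ _) => hA.
have hAt : le_op (A i i) t by apply: ht; exists A.
by have := pos_le u (le_op_pos hAt); lra.
Qed.

(** By normality of the trace of M on the diagonal entries; directedness provides a
member of D that is good for all entries at once. *)
Fact mx_trace_normal (D : set N) (s : N) : D !=set0 ->
  (forall a, D a -> star a = a) ->
  (forall a b, D a -> D b -> exists2 c, D c & le_op a c /\ le_op b c) ->
  is_sup_op D s -> supremums (trace @` D) (trace s).
Proof.
move=> D0 Dsa dir sup_s.
have sup_i i : supremums (trace @` [set A i i | A in D]) (trace (s i i)).
  apply: trace_normal.
  - by have [A DA] := D0; exists (A i i), A.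
  - by move=> _ [A DA <-]; rewrite -[in RHS](Dsa _ DA) mx_starE.
  - move=> _ _ [A DA <-] [B DB <-]; have [C DC [AC BC]] := dir _ _ DA DB.
    by exists (C i i); [exists C|split; exact: le_op_diag].
  - exact: is_sup_diag.
have nV0 : (0 : R[i]) < (n.+1%:R)^-1 by rewrite invr_gt0 ltr0n.
have tr_s A i : D A -> trace (A i i) <= trace (s i i).
  by move=> DA; have [h _] := sup_i i; apply: h; exists (A i i) => //; exists A.
have tr_le A : D A -> trace A <= trace s.
  by move=> DA; rewrite ler_pM2l//; apply: ler_sum => i _; exact: tr_s.
split=> [_ [A DA <-]|t ht]; first exact: tr_le.
have [A0 DA0] := D0.
have tA A : D A -> trace A <= t by move=> DA; apply: ht; exists A.
have Im_t : complex.Im t = complex.Im (trace s).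
  have := tA _ DA0; have := tr_le _ DA0; rewrite !lecE => /andP[/eqP <- _].
  by move=> /andP[/eqP ->].
have [h|h] := leP (complex.Re (trace s)) (complex.Re t).
  by rewrite lecE Im_t eqxx h.
exfalso; set e := complex.Re (trace s) - complex.Re t.
have e0 : 0 < e by rewrite subr_gt0.
have near_i i : exists2 A, D A & tr (s i i) - e < tr (A i i).
  apply: contrapT => hn; have [_ /(_ (trace (s i i) - e%:C))] := sup_i i.
  have ub : ubound (trace @` [set A i i | A in D]) (trace (s i i) - e%:C).
    move=> _ [_ [A DA <-] <-]; have := tr_s A i DA; rewrite !lecE => /andP[/eqP E _].
    rewrite (raddfB (@complex.Im R)) (raddfB (@complex.Re R)) /= subr0 E eqxx /= leNgt; apply/negP => hA.
    by apply: hn; exists A.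
  by move=> /(_ ub); rewrite lecE => /andP[_]; rewrite (raddfB (@complex.Re R)) /=; lra.
have common (r : seq 'I_n.+1) : exists2 A, D A & forall i, i \in r -> tr (s i i) - e < tr (A i i).
  elim: r => [|i r [A DA hA]]; first by exists A0.
  have [B DB hB] := near_i i; have [C DC [AC BC]] := dir _ _ DA DB.
  have Csa X : D X -> star X = X by exact: Dsa.
  have mono X j : D X -> le_op X C -> tr (X j j) <= tr (C j j).
    move=> DX XC; have : trace (X j j) <= trace (C j j).
      apply: trace_le; [by rewrite -[in RHS](Dsa _ DX) mx_starE|
        by rewrite -[in RHS](Dsa _ DC) mx_starE|exact: le_op_diag].
    by rewrite lecE => /andP[].
  exists C => // j; rewrite inE => /orP[/eqP ->|/hA h1].
    exact: lt_le_trans hB (mono _ _ DB BC).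
  exact: lt_le_trans h1 (mono _ _ DA AC).
have [A DA hA] := common (index_enum 'I_n.+1).
have trE (X : N) : complex.Re (trace X) = n.+1%:R^-1 * \sum_i tr (X i i).
  rewrite /trace /= /mx_trace -(rmorph_nat (real_complex R)) -fmorphV.
  rewrite -[\sum_i tr _](raddf_sum (@complex.Re R)).
  by case: (\sum_i _) => a b /=; rewrite mul0r subr0.
have : complex.Re (trace A) <= complex.Re t by have := tA _ DA; rewrite lecE => /andP[].
have : complex.Re (trace s) - e < complex.Re (trace A).
  rewrite !trE; have -> : e = n.+1%:R^-1 * \sum_(i < n.+1) e.
    by rewrite sumr_const card_ord -[e *+ _]mulr_natl mulrA mulVf ?mul1r// pnatr_eq0.
  rewrite -mulrBr -sumrB ltr_pM2l ?invr_gt0 ?ltr0n//.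
  apply: ltr_sum => [|i _]; first by apply/hasP; exists ord0; rewrite ?mem_index_enum.
  by apply: hA; rewrite mem_index_enum.
by rewrite /e; lra.
Qed.
HB.instance Definition _ := VonNeumann_isNormalTracial.Build R N mx_trace_normal.
End MatrixNormal.

(** * Traces of endomorphisms, unitaries of ultrapowers *)

Section TracialFacts.
Context {R : realType}.

(** 1 - u u^* is a projection of trace zero. *)
Lemma isometry_unitary (A : tracialStarAlgType R) (u : A) : star u * u = 1 -> unitary u.
Proof.
move=> uu; split => //; apply/esym/eqP; rewrite -subr_eq0; apply/eqP/sqnorm2_eq0.
have E : (1 - u * star u) * (1 - u * star u) = 1 - u * star u.
  by rewrite mulrBr mulr1 mulrBl mul1r mulrA -(mulrA u) uu mulr1 subrr subr0.
rewrite /sqnorm2 starB star1 starM starK E traceB traceC uu.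
by rewrite subrr.
Qed.

Lemma embedding_sqnorm2 (A B : tracialStarAlgType R) (f : {lrmorphism A -> B}) x :
  embedding f -> sqnorm2 (f x) = sqnorm2 x.
Proof. by move=> [sf tf]; rewrite /sqnorm2 -sf -rmorphM tf. Qed.

Lemma sqnorm2_mul_unitary (A : tracialStarAlgType R) (z u : A) : star u * u = 1 ->
  sqnorm2 (z * star u) = sqnorm2 z.
Proof.
by move=> uu; rewrite /sqnorm2 starM starK -mulrA traceC -!mulrA uu mulr1.
Qed.

Section PolarDistance.
Context {M : tracialVNType R}.
Implicit Types (x y z v : M).

Lemma pos_tr x : pos x -> 0 <= tr x.
Proof.
move=> px; have : trace (0 : M) <= trace x.
  by apply: trace_le; [exact: star_0|case: px|apply: pos_le_op; rewrite subr0].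
by rewrite (raddf0 (@trace R M)) lecE => /andP[].
Qed.

(** With s = |y| and P = v^* v one has y - v = v (s - P) and (s + 1) (s - P) =
P (s^2 - 1), where left multiplication by s + 1 does not decrease the 2-norm. *)
Lemma polar_dist y v : polar_of y v -> sqnorm2 (y - v) <= sqnorm2 (star y * y - 1).
Proof.
move=> [v1 v2 ps ss _]; set s := star v * y in ps ss.
have pv : pisom v by [].
have v_1 := pisom_bounded pv; have pP := pisom_dom pv; set P := star v * v in pP.
have [sP PP] := pP; have [star_s _] := ps.
have Ps : P * s = s.
  have := pisom_star pv; rewrite /pisom starK => h.
  by rewrite /P /s !mulrA h.
have vP : v * P = v by rewrite /P mulrA.
have vs : v * s = y by rewrite /s mulrA.
clearbody s P.
have le1 w z : op_bounded 1 w -> sqnorm2 (w * z) <= sqnorm2 z.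
  by move=> /sqnorm2_mull h; apply: le_trans (h z) _; rewrite expr1n mul1r.
apply: (@le_trans _ _ (sqnorm2 (s - P))).
  by rewrite -{1}vs -{2}vP -mulrBr; exact: le1.
have s1 z : sqnorm2 z <= sqnorm2 ((s + 1) * z).
  rewrite /sqnorm2 starM starD star_1 star_s.
  have -> : star z * (s + 1) * ((s + 1) * z) =
      star z * z + star z * (s + s + s * s) * z.
    rewrite -!mulrA -mulrDr; congr (_ * _).
    rewrite mulrA -{2}[z]mul1r -mulrDl; congr (_ * _).
    by rewrite mulrDl !mulrDr !mulr1 !mul1r [RHS]addrC [s + s + _]addrC !addrA.
  rewrite traceD raddfD /= lerDl; apply: pos_tr; apply: pos_conj.
  apply: posD; first exact: posD.
  by rewrite -{1}star_s; exact: pos_sq.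
apply: le_trans (s1 _) _.
have sP' : s * P = s by rewrite -{1}star_s -{1}sP -starM Ps.
have -> : (s + 1) * (s - P) = P * (star y * y - 1).
  by rewrite -ss [RHS]mulrBr mulrA Ps mulr1 mulrDl mul1r mulrBr sP' addrA subrK.
exact/le1/pisom_bounded/proj_pisom.
Qed.

(** The composition of the trace with f is a tracial state. *)
Lemma endomorphism_trace (f : {lrmorphism M -> M}) : Defs.factor M ->
  star_morphism f -> embedding f.
Proof.
move=> fM sf; split => // x.
have h z : tr (f z) = tr z.
  apply: (@unique_trace _ M fM (fun z => tr (f z))) => {z} => [z w|c z|z w|z||z].
  - by rewrite rmorphD trD.
  - by rewrite linearZ /= /tr traceZ; case: (trace _) => a b /=; rewrite mul0r subr0.
  - by rewrite !rmorphM /tr traceC.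
  - by rewrite rmorphM /= sf; exact: sqnorm2_ge0.
  - by rewrite rmorph1 /tr trace1.
  - by rewrite sf /tr trace_star; case: (trace _).
have := h x; have := h ('i *: x); rewrite linearZ /= /tr !traceZ.
case: (trace (f x)) (trace x) => [a b] [c d] /=.
by rewrite !mul0r !mul1r !sub0r => /oppr_inj -> ->.
Qed.
End PolarDistance.

Section Ultra.
Context {M : tracialVNType R} {I : Type} (U : ultrafilter I).

Lemma sqnorm2_ultraclass (x : @linfty R M I) :
  (fun i => sqnorm2 (x i)) @ ultra_sets U --> sqnorm2 (ultraclass U x).
Proof. by have [h _] := utrace_sqnorm2 U x. Qed.

Lemma ultraclassB (x y : @linfty R M I) :
  ultraclass U x - ultraclass U y = ultraclass U (ladd x (lopp y)).
Proof. by rewrite -uaddE -uoppE. Qed.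
Lemma ultraclassM (x y : @linfty R M I) :
  ultraclass U x * ultraclass U y = ultraclass U (lmul x y).
Proof. exact: umulE. Qed.
Lemma ultraclass_star (x : @linfty R M I) :
  star (ultraclass U x) = ultraclass U (lstar x).
Proof. exact: ustarE. Qed.

(** The phases of the members of any representing family represent p as well, by
[polar_dist]. *)
Lemma isometry_lift (p : ultrapower M U) : star p * p = 1 ->
  exists2 y : @linfty R M I, p = ultraclass U y & forall i, op_bounded 1 (y i).
Proof.
rewrite -(ultraclassK p); move: (repr p) => x; rewrite ultraclass_star ultraclassM => /ultraclassP h.
have /choice[v hv] i : exists v, polar_of (x i) v by exact: polar.
have v1 i : op_bounded 1 (v i) by have [pv _ _ _ _] := hv i; exact: pisom_bounded.
have vb : uniformly_bounded v by exists 1.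
exists (Linfty vb) => //; apply/ultraclassP.
move/unullP: h => h; apply: (unull_le h) => i /=.
exact: polar_dist (hv i).
Qed.
End Ultra.
End TracialFacts.

(** * Conjugating an endomorphism to the identity *)

Section CyclicShift.
Context {R : realType} {M : tracialVNType R} (n : nat).
Variable f : {lrmorphism M -> M}.
Hypothesis f_emb : embedding f.

Local Notation N := (mxM M n).
Let fi k : M -> M := iter k f.

Fact iterD k x y : fi k (x + y) = fi k x + fi k y.
Proof. by elim: k => //= k ->; rewrite rmorphD. Qed.
Fact iterM k x y : fi k (x * y) = fi k x * fi k y.
Proof. by elim: k => //= k ->; rewrite rmorphM. Qed.
Fact iterZ k (a : R[i]) x : fi k (a *: x) = a *: fi k x.
Proof. by elim: k => //= k ->; rewrite linearZ. Qed.
Fact iter1 k : fi k 1 = 1.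
Proof. by elim: k => //= k ->; rewrite rmorph1. Qed.
Fact iter_star k x : fi k (star x) = star (fi k x).
Proof. by elim: k => //= k ->; case: f_emb => ->. Qed.
Fact iter_trace k x : trace (fi k x) = trace x.
Proof. by elim: k => //= k <-; case: f_emb => _ ->. Qed.
Fact iter_sqnorm2 k x : sqnorm2 (fi k x) = sqnorm2 x.
Proof. by elim: k => //= k <-; exact: embedding_sqnorm2. Qed.

Definition orbit_mx x : N := \matrix_(i, k) (if i == k then fi i x else 0).

Fact orbit_mx_linear : linear orbit_mx.
Proof.
move=> a x y; apply/matrixP => i k; rewrite mxE [RHS]mxE mxZE !mxE.
by case: ifP => _; rewrite ?scaler0 ?addr0// iterD iterZ.
Qed.
Fact orbit_mx_monoid : monoid_morphism orbit_mx.
Proof.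
split=> [|x y]; apply/matrixP => i k.
  by rewrite !mxE iter1; case: (i == k).
rewrite mxME mxE (bigD1 i)//= !mxE eqxx big1 ?addr0 => [|j ji].
  by case: ifP => _; rewrite ?mulr0// iterM.
by rewrite !mxE eq_sym (negbTE ji) mul0r.
Qed.
HB.instance Definition _ := GRing.isLinear.Build R[i] M N *:%R orbit_mx orbit_mx_linear.
HB.instance Definition _ := GRing.isMonoidMorphism.Build M N orbit_mx orbit_mx_monoid.
Definition orbit_embed : {lrmorphism M -> N} := orbit_mx.

Fact mx_traceE (A : N) : trace A = (n.+1%:R)^-1 * \sum_i trace (A i i).
Proof. by []. Qed.

Lemma orbit_embedding : embedding orbit_embed.
Proof.
split=> x.
  apply/matrixP => i k; rewrite mx_starE !mxE eq_sym; case: eqVneq => [->|_].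
    by rewrite iter_star.
  by rewrite star_0.
rewrite mx_traceE (eq_bigr (fun=> trace x)) => [|i _].
  by rewrite sumr_const card_ord -[trace x *+ _]mulr_natl mulrA mulVf ?mul1r// pnatr_eq0.
by rewrite mxE eqxx iter_trace.
Qed.

Definition shift_mx : N := \matrix_(i, k) (i == ordS k)%:R.

Lemma shift_isometry : star shift_mx * shift_mx = 1.
Proof.
apply/matrixP => i k; rewrite mxME (bigD1 (ordS i))//= big1 => [|l li].
  rewrite addr0 mx_starE !mxE eqxx star_1 mul1r (inj_eq (@ordS_inj n.+1)).
  by [].
by rewrite mx_starE !mxE (negbTE li) star_0 mul0r.
Qed.

(** Conjugation by the shift moves f^(k+1) x from position k to position k + 1, where
it meets its match; only in the first position, reached from the last one, does
f^(n+1) x meet x instead. *)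
Lemma shift_orbit x :
  sqnorm2 (shift_mx * orbit_embed (f x) * star shift_mx - orbit_embed x) <=
  4 * sqnorm2 x / n.+1%:R.
Proof.
have uu := isometry_unitary shift_isometry.
have -> : shift_mx * orbit_embed (f x) * star shift_mx - orbit_embed x =
    (shift_mx * orbit_embed (f x) - orbit_embed x * shift_mx) * star shift_mx.
  by case: uu => _ uu; rewrite mulrBl -(mulrA (orbit_embed x)) uu mulr1.
rewrite sqnorm2_mul_unitary; last exact: shift_isometry.
set E := _ - _.
have Eik i k : E i k = if (i == ordS k) && (k == ord_max) then fi n.+1 x - x else 0.
  rewrite mxBE !mxME (bigD1 k)//= big1 => [|j jk]; last first.
    by rewrite !mxE (negbTE jk) mulr0.
  rewrite [X in _ - X](bigD1 i)//= [X in _ - (_ + X)]big1 => [|j ji]; last first.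
    by rewrite !mxE eq_sym (negbTE ji) mul0r.
  rewrite !addr0 !mxE !eqxx; case: eqVneq => [->|_]; last by rewrite mulr0 mul0r subrr.
  rewrite mul1r mulr1 /= -/(fi _ _) -/(fi _ _).
  have -> : fi k (f x) = fi k.+1 x by rewrite /fi -iterSr.
  case: eqVneq => [->|kn]; first by rewrite /= modnn.
  rewrite modn_small ?subrr// ltnS ltn_neqAle -ltnS ltn_ord andbT.
  by apply: contra_neq kn => h; apply: val_inj.
rewrite {1}/sqnorm2 mx_traceE mx_trace_sq.
have -> : \sum_i \sum_k trace (star (E k i) * E k i) =
    trace (star (fi n.+1 x - x) * (fi n.+1 x - x)).
  rewrite (bigD1 ord_max)//= (bigD1 (ordS ord_max))//= Eik !eqxx /=.
  rewrite big1 => [|k kS]; last by rewrite Eik (negbTE kS) mulr0 (raddf0 (@trace R M)).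
  rewrite big1 ?addr0// => i im; rewrite big1// => k _.
  by rewrite Eik (negbTE im) andbF mulr0 (raddf0 (@trace R M)).
rewrite traceE2 -(rmorph_nat (real_complex R)) -fmorphV -(rmorphM (real_complex R)) /=.
rewrite mulrC ler_pM2r ?invr_gt0 ?ltr0n//.
apply: le_trans (sqnorm2D _ _) _; rewrite sqnorm2N -[f _]/(fi n.+1 x) iter_sqnorm2.
by lra.
Qed.
End CyclicShift.

Section Conjugation.
Context {R : realType} {M : tracialVNType R}.
Implicit Types (x y v : M).
Hypothesis M_ec : existentially_closed M.

(** The shift matrix is sent by existential closedness to a unitary of an ultrapower,
and represented there by contractions; n is so large that the corner that the shift
does not match contributes less than e. *)
Lemma approx_inner (f : {lrmorphism M -> M}) (k : nat) (d : 'I_k -> M) (e : R) :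
  embedding f -> 0 < e ->
  exists v, [/\ op_bounded 1 v, sqnorm2 (star v * v - 1) < e &
    forall l, sqnorm2 (v * f (d l) * star v - d l) < e].
Proof.
move=> fe e0; pose C := \sum_l 4 * sqnorm2 (d l) / e.
have Cl l : 4 * sqnorm2 (d l) / e <= C.
  rewrite /C (bigD1 l)//= lerDl; apply: sumr_ge0 => j _.
  by rewrite divr_ge0 ?(ltW e0)// mulr_ge0 ?sqnorm2_ge0.
have C0 : 0 <= C.
  by apply: sumr_ge0 => j _; rewrite divr_ge0 ?(ltW e0)// mulr_ge0 ?sqnorm2_ge0.
pose n := Num.bound C; pose w := shift_mx (M := M) n.
have [I [U [g [ge gd]]]] := M_ec (orbit_embedding n fe).
have gw : star (g w) * g w = 1.
  by case: ge => sg _; rewrite -sg -rmorphM shift_isometry rmorph1.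
have [y yE y1] := isometry_lift gw.
have near1 : \forall i \near ultra_sets U, sqnorm2 (star (y i) * y i - 1) < e.
  move: gw; rewrite yE ultraclass_star ultraclassM => /ultraclassP /unullP h.
  exact: (cvgr_lt _ h).
have near2 l : \forall i \near ultra_sets U,
    sqnorm2 (y i * f (d l) * star (y i) - d l) < e.
  have E : g (w * orbit_embed n f (f (d l)) * star w - orbit_embed n f (d l)) =
      ultraclass U (ladd (lmul (lmul y (lcst (f (d l)))) (lstar y)) (lopp (lcst (d l)))).
    rewrite rmorphB !rmorphM /= !gd; case: ge => sg _; rewrite sg yE /diag.
    by rewrite ultraclass_star (ultraclassM U y) ultraclassM ultraclassB.
  have h : (fun i => sqnorm2 (y i * f (d l) * star (y i) - d l)) @ ultra_sets U -->
      sqnorm2 (w * orbit_embed n f (f (d l)) * star w - orbit_embed n f (d l)).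
    by rewrite -(embedding_sqnorm2 _ ge) E; exact: sqnorm2_ultraclass.
  apply: (cvgr_lt _ h); apply: le_lt_trans (shift_orbit n fe (d l)) _.
  rewrite ltr_pdivrMr ?ltr0n// -ltr_pdivrMl// mulrC.
  apply: le_lt_trans (Cl l) _; apply: lt_trans (archi_boundP C0) _.
  by rewrite ltr_nat.
have [i [h1 h2]] : exists i, sqnorm2 (star (y i) * y i - 1) < e /\
    forall l, sqnorm2 (y i * f (d l) * star (y i) - d l) < e.
  apply: (@filter_ex _ (ultra_sets U)); apply: filterI => //.
  exact: filter_forall.
by exists (y i).
Qed.
End Conjugation.

Lemma nonprincipal_tail (U : ultrafilter nat) (n : nat) : nonprincipal U ->
  \forall i \near ultra_sets U, (n <= i)%N.
Proof.
move=> hU; have nU k : ultra_sets U (~` [set k]).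
  have [h|//] := in_ultra_setVsetC [set k] (ultraP U).
  exfalso; apply: hU; exists k; apply/seteqP; split=> A.
    move=> UA; apply/principal_filterP.
    have [j [/= jk Aj]] := filter_ex (filterI h UA).
    by rewrite -jk.
  by move=> /principal_filterP Ak; apply: filterS h => j ->.
elim: n => [|n IH]; first exact: nearW.
by apply: filterS2 IH (nU n) => i ni /eqP /= i_n; rewrite ltn_neqAle eq_sym i_n.
Qed.

Theorem mainTheorem4 (R : realType) (M : tracialVNType R) :
  II1_factor M -> separable M -> existentially_closed M ->
  self_tracially_stable M -> jung_property M.
Proof.
move=> [Mf _] [d dM] Mec Mst U Unp f fe.
have [f_ [f_star f_rep]] := Mst U Unp f fe.
have f_emb i : embedding (f_ i) by exact: endomorphism_trace.
have ip0 i : 0 < (i.+1%:R : R)^-1 by rewrite invr_gt0 ltr0n.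
have /choice[v hv] i := approx_inner Mec (fun l : 'I_i.+1 => d l) (f_emb i) (ip0 i).
have vb : uniformly_bounded v by exists 1 => i; case: (hv i).
pose u := Linfty vb.
have tail (e : R) : 0 < e -> \forall i \near ultra_sets U, (i.+1%:R : R)^-1 < e.
  move=> e0; apply: filterS (nonprincipal_tail (Num.bound e^-1) Unp) => i hi.
  rewrite invf_plt ?posrE ?ltr0n//; apply: lt_le_trans (archi_boundP _) _.
    by rewrite invr_ge0 ltW.
  by rewrite ler_nat leqW.
exists (ultraclass U u); split.
  apply: isometry_unitary; rewrite ultraclass_star ultraclassM.
  apply/ultraclassP/unullP/cvgrPdist_lt => e e0.
  apply: filterS (tail _ e0) => i; rewrite sub0r normrN ger0_norm ?sqnorm2_ge0//.
  by apply: lt_trans; have [_ h _] := hv i.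
move=> x; have [y yE ->] := f_rep x.
rewrite ultraclass_star (ultraclassM U u) ultraclassM.
apply/ultraclassP/unullP/cvgrPdist_lt => e e0.
have e12 : 0 < Num.sqrt (e / 12) by rewrite sqrtr_gt0 divr_gt0.
have [n hn] := dM x _ e12.
have hn2 : sqnorm2 (x - d n) < e / 12.
  rewrite -norm2_sqr -[ltRHS]sqr_sqrtr ?divr_ge0 ?(ltW e0)//.
  by rewrite ltr_sqr ?nnegrE ?sqrtr_ge0.
have e8 : 0 < e / 8 by rewrite divr_gt0.
apply: filterS2 (tail _ e8) (nonprincipal_tail n Unp) => i hi ni.
rewrite sub0r normrN ger0_norm ?sqnorm2_ge0//= yE.
have [v1 _ hd] := hv i.
have ni' : (n < i.+1)%N by rewrite ltnS.
have {hd} hb := lt_trans (hd (Ordinal ni')) hi; rewrite /= in hb.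
have v1s : op_bounded 1 (star (v i)) by exact: op_bounded_star.
have ha : sqnorm2 (v i * f_ i (x - d n) * star (v i)) <= sqnorm2 (x - d n).
  apply: le_trans (sqnorm2_mulr _ ltr01 v1s) _; rewrite expr1n mul1r.
  apply: le_trans (sqnorm2_mull _ v1) _; rewrite expr1n mul1r.
  by rewrite embedding_sqnorm2.
(* The squared 2-norms of the three terms are below e/12, e/8 and e/12, and the
   parallelogram bound weights them by 4, 4 and 2. *)
have -> : v i * f_ i x * star (v i) - x = v i * f_ i (x - d n) * star (v i) +
    (v i * f_ i (d n) * star (v i) - d n) + - (x - d n).
  by rewrite rmorphB mulrBr mulrBl opprB !addrA !subrK.
apply: le_lt_trans (sqnorm2D _ _) _; rewrite sqnorm2N.
have := sqnorm2D (v i * f_ i (x - d n) * star (v i))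
  (v i * f_ i (d n) * star (v i) - d n).
lra.
Qed.
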